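(* Let $k$ be an algebraically closed field of characteristic $2$, $S=\mathbf{V}(g)\subset\mathbb{A}^3$ with $g = x^2+y^2z+yz^2+xyz$, and $m\ge 5$. Let $R_m = k[x_0,\dots,x_m,y_0,\dots,y_m,z_0,\dots,z_m]$, $(\mathbb{A}^3)_m=\mathrm{Spec}\,R_m$, and define $g^{(j)}\in R_m$ by $g(\sum_{i=0}^m x_it^i,\sum_{i=0}^m y_it^i,\sum_{i=0}^m z_it^i)=\sum_{j=0}^m g^{(j)}t^j$ in $R_m[t]/\langle t^{m+1}\rangle$. Let $S_m^0=\mathbf{V}(x_0,y_0,z_0,g^{(0)},\dots,g^{(m)})$ be the singular fiber of the $m$-th jet scheme $S_m=\mathrm{Spec}\,R_m/\langle g^{(0)},\dots,g^{(m)}\rangle$ (the fiber over $0$ of the truncation $S_m\to S$). Define $I_m^0 = \langle x_0,x_1,x_2,y_0,y_1,z_0,z_1\rangle + \langle g^{(0)},\dots,g^{(m)}\rangle$, $I_m^1 = J_m^1 (R_m)_{z_1}\cap R_m$, $I_m^2 = J_m^2 (R_m)_{y_1}\cap R_m$, $I_m^3 = J_m^3 (R_m)_{y_1}\cap R_m$, where $J_m^1 = \langle x_0,x_1,y_0,y_1,z_0\rangle + \langle g^{(0)},\dots,g^{(m)}\rangle$, $J_m^2 = \langle x_0,x_1,y_0,z_0,z_1\rangle + \langle g^{(0)},\dots,g^{(m)}\rangle$, $J_m^3 = \langle x_0,x_1,y_0,z_0,y_1+z_1\rangle + \langle g^{(0)},\dots,g^{(m)}\rangle$, and $Z_m^i=\mathbf{V}(I_m^i)$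 for $i=0,1,2,3$. Then the irreducible decomposition of $S_m^0$ is $$S_m^0=Z_m^0\cup Z_m^1\cup Z_m^2\cup Z_m^3.$$
   Context: $(R_m)_h$ is the localization at powers of $h$, $J(R_m)_h\cap R_m$ the preimage in $R_m$ of the extended ideal, and $\mathbf{V}(\cdot)$ the zero set in $(\mathbb{A}^3)_m$. $S$ has a rational double point of type $D_4^1$ at the origin. *)

(* Defs.v *)
From HB Require Import structures.
From mathcomp Require Import all_boot all_order all_algebra.
From mathcomp Require Import mpoly.
Set Implicit Arguments. Unset Strict Implicit. Unset Printing Implicit Defensive.
Import Order.TTheory GRing.Theory Num.Theory.
Local Open Scope ring_scope.

(* Jet scheme setup: R_m = k[x_0..x_m, y_0..y_m, z_0..z_m] realised as
   {mpoly k[NV m]} with NV m = 3(m+1) variables; x_i is variable i,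
   y_i is variable (m+1)+i, z_i is variable 2(m+1)+i. *)
Definition NV (m : nat) : nat := (m.+1 + m.+1 + m.+1)%N.

Section Jets.
Variables (k : fieldType) (m : nat).
Local Notation Rm := {mpoly k[NV m]}.

Definition xv (i : nat) : Rm := 'X_(lshift m.+1 (lshift m.+1 (@inord m i))).
Definition yv (i : nat) : Rm := 'X_(lshift m.+1 (rshift m.+1 (@inord m i))).
Definition zv (i : nat) : Rm := 'X_(rshift (m.+1 + m.+1) (@inord m i)).

Definition Xt : {poly Rm} := \poly_(i < m.+1) xv i.
Definition Yt : {poly Rm} := \poly_(i < m.+1) yv i.
Definition Zt : {poly Rm} := \poly_(i < m.+1) zv i.

Definition gt : {poly Rm} :=
  Xt ^+ 2 + Yt ^+ 2 * Zt + Yt * Zt ^+ 2 + Xt * Yt * Zt.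

(* g^{(j)}: coefficient of t^j (j <= m; truncation mod t^{m+1} does not
   affect these coefficients) *)
Definition gj (j : nat) : Rm := gt`_j.

Definition gens_g : seq Rm := [seq gj j | j <- iota 0 m.+1].

End Jets.

Definition in_ideal (R : comRingType) (n : nat) (gs : seq {mpoly R[n]})
  (f : {mpoly R[n]}) : Prop :=
  exists c : 'I_(size gs) -> {mpoly R[n]},
    f = \sum_(i < size gs) c i * gs`_i.

(* J (R_m)_h \cap R_m : saturation of the ideal generated by gs w.r.t. h *)
Definition in_sat (R : comRingType) (n : nat) (gs : seq {mpoly R[n]})
  (h : {mpoly R[n]}) (f : {mpoly R[n]}) : Prop :=
  exists e : nat, in_ideal gs (h ^+ e * f).

Definition Vset (R : comRingType) (n : nat) (I : {mpoly R[n]} -> Prop)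
  : ('I_n -> R) -> Prop :=
  fun v => forall p, I p -> p.@[v] = 0.

Definition zclosed (R : comRingType) (n : nat) (A : ('I_n -> R) -> Prop) : Prop :=
  exists I : {mpoly R[n]} -> Prop, forall v, A v <-> Vset I v.

Definition zirreducible (R : comRingType) (n : nat) (A : ('I_n -> R) -> Prop)
  : Prop :=
  (exists v, A v) /\
  forall B C : ('I_n -> R) -> Prop, zclosed B -> zclosed C ->
    (forall v, A v -> B v \/ C v) ->
    (forall v, A v -> B v) \/ (forall v, A v -> C v).

Definition irreducible_decomposition (R : comRingType) (n p : nat)
  (A : ('I_n -> R) -> Prop) (Z : 'I_p -> ('I_n -> R) -> Prop) : Prop :=
  (forall v, A v <-> exists i, Z i v) /\
  (forall i, zclosed (Z i) /\ zirreducible (Z i)) /\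
  (forall i j, i != j -> ~ (forall v, Z i v -> Z j v)).

Section Ideals.
Variables (k : fieldType) (m : nat).
Local Notation Rm := {mpoly k[NV m]}.
Local Notation x := (@xv k m).
Local Notation y := (@yv k m).
Local Notation z := (@zv k m).
Local Notation G := (@gens_g k m).

Definition S0_m : ('I_(NV m) -> k) -> Prop :=
  Vset (in_ideal ([:: x 0; y 0; z 0] ++ G)).

Definition I0_m : Rm -> Prop :=
  in_ideal ([:: x 0; x 1; x 2; y 0; y 1; z 0; z 1] ++ G).
Definition J1_m : seq Rm := [:: x 0; x 1; y 0; y 1; z 0] ++ G.
Definition J2_m : seq Rm := [:: x 0; x 1; y 0; z 0; z 1] ++ G.
Definition J3_m : seq Rm := [:: x 0; x 1; y 0; z 0; y 1 + z 1] ++ G.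
Definition I1_m : Rm -> Prop := in_sat J1_m (z 1).
Definition I2_m : Rm -> Prop := in_sat J2_m (y 1).
Definition I3_m : Rm -> Prop := in_sat J3_m (y 1).

Definition Z_m (i : 'I_4) : ('I_(NV m) -> k) -> Prop :=
  match val i with
  | 0 => Vset I0_m
  | 1 => Vset I1_m
  | 2 => Vset I2_m
  | _ => Vset I3_m
  end%N.
End Ideals.

(* Main.v *)
(* By the Nullstellensatz only points matter. A point is a triple (x, y, z) of
   polynomials in t, truncated at t^(m+1), with x^2 + y^2 z + y z^2 + x y z = 0.
   For i = 1, 2, 3, the set Z_i is the closure of a locus where x has order at
   least 2, one of y and z, say z, has order exactly 1, and y_1 = 0 or y_1 = z_1.
   There, since 2 = 0, the coefficient of t^(j+2) equals z_1^2 y_j plus terms in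
   lower coefficients of y; it can be solved for y_j, so the locus is parametrised
   by an open subset of an affine space.

   The locus z_2 <> 0 of Z_0 is parametrised in the same way: the coefficient of
   t^6 reads x_3^2 = y_2 z_2 (y_2 + z_2), which becomes solvable once y_2 and z_2
   are written as squares. The main point is that this locus is dense in Z_0.
   Otherwise y_2 = z_2 = 0 on a nonempty open subset of Z_0; let a >= 3 be the
   minimal order of y and z on it. Near a point of order a, the equations determine
   so many coordinates that fixing at most 2m others isolates the point. But Z_0 is
   cut out by m + 2 equations in 3m + 3 variables, and fewer than n equations never
   isolate a point of n-space, by a Hilbert-Samuel count in the local ring. *)
From HB Require Import structures.
Require Import Defs.
From mathcomp Require Import all_boot all_order all_algebra.
From mathcomp Require Import mpoly zify ring.
From mathcomp Require boolp classical_sets.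
Set Implicit Arguments. Unset Strict Implicit. Unset Printing Implicit Defensive.
Import GRing.Theory.
Local Open Scope ring_scope.

(** * Prime ideals *)

Definition is_ideal (R : comNzRingType) (I : R -> Prop) : Prop :=
  [/\ I 0, forall a b, I a -> I b -> I (a + b) & forall r a, I a -> I (r * a)].

Definition is_prime_ideal (R : comNzRingType) (P : R -> Prop) : Prop :=
  is_ideal P /\ forall a b, P (a * b) -> P a \/ P b.

Section PrimeIdeals.
Variable R : comNzRingType.
Implicit Types (I P : R -> Prop).

Lemma ideal_opp I a : is_ideal I -> I a -> I (- a).
Proof. by case=> _ _ IM Ia; rewrite -mulN1r; apply: IM. Qed.

Lemma ideal_sub I a b : is_ideal I -> I a -> I b -> I (a - b).
Proof.
by move=> idI Ia Ib; case: (idI) => _ ID _; apply: ID => //; apply: ideal_opp.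
Qed.

Lemma ideal_sum I (T : Type) (r : seq T) (Q : pred T) (F : T -> R) :
  is_ideal I -> (forall i, Q i -> I (F i)) -> I (\sum_(i <- r | Q i) F i).
Proof. by case=> I0 ID _ IF; apply: (big_ind I). Qed.

Lemma prime_exp P a e : is_prime_ideal P -> ~ P 1 -> P (a ^+ e) -> P a.
Proof.
move=> [_ PM] P1; elim: e => [|e IHe]; first by rewrite expr0.
by rewrite exprS => /PM[].
Qed.

(** The ideal generated by [I] and [a], for an ideal [I]. *)
Definition ideal_adjoin I a : R -> Prop :=
  fun b => exists r, I (b - r * a).

Lemma ideal_adjoin_ideal I a : is_ideal I -> is_ideal (ideal_adjoin I a).
Proof.
move=> idI; case: (idI) => I0 ID IM; split.
- by exists 0; rewrite mul0r subr0.
- move=> b c [r Ir] [s Is]; exists (r + s).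
  by have := ID _ _ Ir Is; congr I; ring.
- move=> s b [r Ir]; exists (s * r).
  by have := IM s _ Ir; congr I; ring.
Qed.

(** Zorn's lemma gives an ideal maximal among those that contain [I] and no power of [p]; maximality
    makes it prime. *)
Lemma prime_avoiding_powers I p :
    is_ideal I -> (forall e, ~ I (p ^+ e)) ->
  exists P, [/\ is_prime_ideal P, forall a, I a -> P a & ~ P p].
Proof.
move=> idI Ip.
pose Q (X : R -> Prop) := (forall a, ~ X a) \/
  [/\ is_ideal X, forall a, I a -> X a & forall e, ~ X (p ^+ e)].
have [F FQ Ftot|A [QA Amax]] := @classical_sets.Zorn_bigcup R Q.
  have [[X [FX [x Xx]]]|Fe] :=
      boolp.EM (exists X, F X /\ exists x, X x); last first.
    by left=> a [X FX Xa]; apply: Fe; exists X; split => //; exists a.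
  have idF Y y : F Y -> Y y ->
      [/\ is_ideal Y, forall a, I a -> Y a & forall e, ~ Y (p ^+ e)].
    by move=> FY Yy; case: (FQ _ FY) => // /(_ y).
  have [[X0 _ _] XI _] := idF X x FX Xx.
  right; split=> [|a Ia|e [Y FY Yp]].
  - split; first by exists X.
      move=> a b [Y FY Ya] [Z FZ Zb].
      case: (Ftot _ _ FY FZ) => [YZ|ZY].
        exists Z => //; have [[_ ZD _] _ _] := idF Z b FZ Zb.
        by apply: ZD => //; apply: YZ.
      exists Y => //; have [[_ YD _] _ _] := idF Y a FY Ya.
      by apply: YD => //; apply: ZY.
    move=> r a [Y FY Ya]; exists Y => //.
    by have [[_ _ YM] _ _] := idF Y a FY Ya; apply: YM.
  - by exists X => //; apply: XI.
  - by have [_ _ /(_ e)] := idF Y _ FY Yp.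
have [I0 _ _] := idI.
have {QA}[idA IA Ap] : [/\ is_ideal A, forall a, I a -> A a
    & forall e, ~ A (p ^+ e)].
  case: QA => // Ae; case: (Amax I); last by right.
  by split=> [a /Ae|/(_ 0 I0) /Ae].
have adj a : ~ A a -> exists e, ideal_adjoin A a (p ^+ e).
  move=> Aa; apply: boolp.contrapT => noe.
  have idAa := ideal_adjoin_ideal a idA.
  have AAa b : A b -> ideal_adjoin A a b.
    by move=> Ab; exists 0; rewrite mul0r subr0.
  case: (Amax (ideal_adjoin A a)).
    split=> // AaA; apply/Aa/AaA; exists 1; rewrite mul1r subrr.
    by case: idA.
  right; split=> // [b /IA /AAa //|e Aae]; apply: noe.
  by exists e.
exists A; split=> //; last by move=> Ap1; apply: (Ap 1); rewrite expr1.
split=> // a b Aab; apply: boolp.contrapT => nab.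
(* By maximality p^e = r a and p^f = s b modulo [A]; multiplying puts p^(e+f) in [A] as soon as a b
   is there. *)
have [|e [r Ar]] := adj a; first by move=> Aa; apply: nab; left.
have [|f [s As]] := adj b; first by move=> Ab; apply: nab; right.
apply: (Ap (e + f)%N); rewrite exprD.
have -> : p ^+ e * p ^+ f = p ^+ f * (p ^+ e - r * a)
    + (r * a * (p ^+ f - s * b) + r * s * (a * b)) by ring.
by case: idA => _ AD AM; do 2?[apply: (AD)]; apply: AM.
Qed.

End PrimeIdeals.

Lemma min_size_poly (R : nzRingType) (Q : {poly R} -> Prop) p0 : Q p0 ->
  exists2 p, Q p & forall q, Q q -> (size p <= size q)%N.
Proof.
have [n] := ubnP (size p0); elim: n p0 => // n IHn p0 p0n Qp0.
have [[q Qq qp0]|noq] := boolp.EM (exists2 q, Q q & (size q < size p0)%N).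
  by apply: IHn Qq; apply: leq_trans qp0 _.
exists p0 => // q Qq; rewrite leqNgt; apply/negP => qp0.
by apply: noq; exists q.
Qed.

(** * The one-variable step of the Nullstellensatz *)

Section PrimeExtension.
Variables (B : idomainType) (K : closedFieldType) (P : {poly B} -> Prop).
Hypothesis primeP : is_prime_ideal P.
Implicit Types (p q g h : {poly B}) (c : B).

Let idP := primeP.1.

Let PC c := P c%:P.

Let PZ c p : PC c -> P (c *: p).
Proof. by rewrite -mul_polyC mulrC; case: idP => _ _; apply. Qed.

Let P_coef p : (forall i, PC p`_i) -> P p.
Proof.
move=> Pp; rewrite -[p]coefK poly_def.
by apply: ideal_sum => // i _; apply: PZ.
Qed.

Let P_drop_lead p : PC (lead_coef p) ->
  P (p - take_poly (size p).-1 p).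
Proof.
move=> Plp; apply: P_coef => i; rewrite coefB coef_take_poly.
case: ltngtP => [ip|ip|->]; rewrite ?subrr ?subr0.
- by case: idP.
- by rewrite nth_default; [case: idP | case: (size p) ip].
- by rewrite -lead_coefE.
Qed.

Let size_drop_lead (p : {poly B}) : p != 0 ->
  (size (take_poly (size p).-1 p) < size p)%N.
Proof.
rewrite -size_poly_gt0 => p0.
by apply: leq_ltn_trans (size_take_poly _ _) _; rewrite prednK.
Qed.

(* Above a point of the base where [b] does not vanish, the ideal [P] cuts out
   the roots of one element [f] of [P] of minimal degree, and [h] is invertible
   modulo [P]. *)
Lemma prime_extension h : ~ P h ->
  exists2 b, ~ P b%:P & forall phi : {rmorphism B -> K},
    (forall c, P c%:P -> phi c = 0) -> phi b != 0 ->
    exists2 x, forall p, P p -> (map_poly phi p).[x] = 0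
             & (map_poly phi h).[x] != 0.
Proof.
move=> Ph; case: (idP) => P0 PD PM.
have P1 : ~ PC 1 by move=> P1; apply: Ph; rewrite -[h]mulr1; apply: PM.
have mapP0 (phi : {rmorphism B -> K}) p :
    (forall c, P c%:P -> phi c = 0) -> (forall i, PC p`_i) -> map_poly phi p = 0.
  by move=> phiP Pp; apply/polyP => i; rewrite coef_map coef0; apply/phiP/Pp.
(* If all coefficients of elements of [P] lie in [P], some coefficient of [h] does not; where it is
   nonzero, the specialised [h] has a nonroot. *)
have [Pall|] := boolp.EM (forall p, P p -> forall i, PC p`_i).
  have [i Phi] : exists i, ~ PC h`_i.
    apply: boolp.contrapT => noi; apply/Ph/P_coef => i.
    by apply: boolp.contrapT => Phi; apply: noi; exists i.
  exists h`_i => // phi phiP phih.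
  have /closed_nonrootP[x hx] : map_poly phi h != 0.
    by apply: contraNneq phih => h0; rewrite -coef_map h0 coef0.
  by exists x => // p Pp; rewrite (mapP0 _ _ phiP (Pall p Pp)) horner0.
move=> /boolp.existsNP[p0 /boolp.not_implyP[Pp0 /boolp.existsNP bad0]].
(* The leading coefficient of this [f] is outside [P]: otherwise dropping the leading term would
   give a smaller choice. *)
have [f [Pf [i fi]] fmin] :=
  @min_size_poly _ (fun p => P p /\ exists i, ~ PC p`_i) p0 (conj Pp0 bad0).
have Psmall g : P g -> (size g < size f)%N -> forall j, PC g`_j.
  move=> Pg; rewrite ltnNge => /negP gf j; apply: boolp.contrapT => gj.
  by apply: gf; apply: fmin; split => //; exists j.
have f0 : f != 0 by apply/eqP => f0; apply: fi; rewrite f0 coef0.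
have lf : ~ PC (lead_coef f).
  move=> lf; have Pd := P_drop_lead lf.
  have Pt : P (take_poly (size f).-1 f).
    by rewrite -(subKr f (take_poly _ _)); apply: ideal_sub.
  have tj := Psmall _ Pt (size_drop_lead f0).
  apply: fi; have [ifs|] := ltnP i (size f).-1.
    by have := tj i; rewrite coef_take_poly ifs.
  rewrite leq_eqVlt => /orP[/eqP <-//|ifs].
  by rewrite nth_default; [rewrite /PC polyC0 | case: (size f) ifs].
have PCX c e : ~ PC c -> ~ PC (c ^+ e).
  by rewrite /PC rmorphXn => Pc /(prime_exp primeP P1).
have PZE c p : ~ PC c -> P (c *: p) -> P p.
  by rewrite -mul_polyC => Pc /primeP.2[].
have f1 : (1 < size f)%N.
  rewrite ltnNge; apply/negP => f1; apply: lf; rewrite /PC lead_coefE.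
  by rewrite (_ : _.-1 = 0%N) -?size1_polyC //; case: (size f) f1 => [|[]].
(* A smallest element of P + (h) outside [P] will turn out to be constant, so that [h] becomes a
   unit modulo [P] once this constant is inverted. *)
pose Q g := ideal_adjoin P h g /\ ~ P g.
have idQ := ideal_adjoin_ideal h idP.
have PQ g : P g -> ideal_adjoin P h g.
  by move=> Pg; exists 0; rewrite mul0r subr0.
pose r := h %% f.
have Er := Pdiv.Idomain.divp_eq h f.
have Qr : Q r.
  split.
    exists (lead_coef f ^+ scalp h f)%:P.
    rewrite mul_polyC Er opprD addrCA subrr addr0.
    by rewrite -mulNr; apply: PM.
  move=> Pr; apply: Ph; apply: (PZE (lead_coef f ^+ scalp h f)); first exact: PCX.
  by rewrite Er; apply: PD => //; apply: PM.
have [g [Qg Pg] gmin] := min_size_poly Qr.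
have gf : (size g < size f)%N.
  by apply: leq_ltn_trans (gmin _ Qr) _; rewrite ltn_modp.
have g0 : g != 0 by apply/eqP => g0; apply: Pg; rewrite g0.
have lg : ~ PC (lead_coef g).
  move=> lg; have Pd := P_drop_lead lg.
  have := size_drop_lead g0; rewrite ltnNge => /negP; apply; apply: gmin; split.
    by rewrite -(subKr g (take_poly _ _)); apply: ideal_sub => //; apply: PQ.
  by move=> Pt; apply: Pg; rewrite -(subrK (take_poly (size g).-1 g) g); apply: PD.
(* Pseudo-divide [f] by [g]. The remainder is in [P] by minimality of [g], hence the quotient too by
   primality. If [g] is not constant, both are smaller than [f] and have their coefficients in [P],
   which forces the leading coefficient of [f] into [P]. *)
have {lg} g1 : (size g <= 1)%N.
  rewrite leqNgt; apply/negP => g1.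
  have := Pdiv.Idomain.divp_eq f g; set q := _ %/ _; set s := _ %% _.
  set c := _ ^+ _ => E.
  have Pc : ~ PC c by apply: PCX.
  have sg : (size s < size g)%N by rewrite ltn_modp.
  have Ps : P s.
    apply: boolp.contrapT => Ps; move: sg; rewrite ltnNge => /negP; apply.
    apply: gmin; split=> //.
    have -> : s = c *: f - q * g by rewrite E addrC addKr.
    apply: ideal_sub => //; first by apply: PQ; rewrite -mul_polyC; apply: PM.
    by case: idQ => _ _; apply.
  have Pqg : P (q * g).
    have -> : q * g = c *: f - s by rewrite E addrK.
    by apply: ideal_sub => //; rewrite -mul_polyC; apply: PM.
  have Pq : P q by case: (primeP.2 _ _ Pqg).
  have qf : (size q < size f)%N.
    have [->|q0] := eqVneq q 0; first by rewrite size_poly0; lia.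
    have : (size (q * g)%R <= size f)%N.
      have -> : q * g = c *: f - s by rewrite E addrK.
      apply: leq_trans (size_polyD _ _) _.
      by rewrite geq_max size_scale_leq size_polyN ltnW //; apply: ltn_trans sg gf.
    by rewrite size_mul //; move: (size q) (size g) (size f) g1 => *; lia.
  have Pqi := Psmall _ Pq qf.
  have Psi := Psmall _ Ps (ltn_trans sg gf).
  have : PC (c * lead_coef f).
    rewrite lead_coefE -coefZ E coefD /PC polyCD; apply: PD; last exact: Psi.
    rewrite coefM rmorph_sum /=; apply: ideal_sum => // j _.
    by rewrite mulrC polyCM; apply: PM; apply: Pqi.
  by rewrite /PC polyCM => /primeP.2[].
have {g1} gE := size1_polyC g1.
(* The first factor keeps the degree of [f] positive, so that a root exists; the second keeps [h]
   from vanishing there, being a multiple of [h] modulo [P]. *)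
exists (lead_coef f * g`_0).
  by rewrite polyCM -gE => /primeP.2[].
move=> phi phiP; rewrite rmorphM mulf_eq0 negb_or => /andP[phif phig].
have sf : size (map_poly phi f) = size f by apply: size_map_poly_id0.
have /closed_rootP[x /rootP fx] : size (map_poly phi f) != 1%N by rewrite sf; lia.
have Px p : P p -> (map_poly phi p).[x] = 0.
  move=> Pp; have := Pdiv.Idomain.divp_eq p f.
  set c := _ ^+ _ => E.
  have Pr : P (p %% f).
    have -> : p %% f = c *: p - p %/ f * f by rewrite E addrC addKr.
    by apply: ideal_sub => //; rewrite -?mul_polyC; apply: PM.
  have := congr1 (fun q => (map_poly phi q).[x]) E.
  rewrite map_polyZ hornerZ rmorphD rmorphM hornerD hornerM /= fx mulr0 add0r.
  rewrite (mapP0 _ (p %% f) phiP) ?horner0; last first.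
    by apply: Psmall; rewrite ?ltn_modp.
  by move/eqP; rewrite mulf_eq0 rmorphXn expf_eq0 (negPf phif) andbF => /eqP.
exists x => //; case: Qg => a Pa.
apply: contraNneq phig => hx.
have := Px _ Pa; rewrite rmorphB rmorphM hornerD hornerN hornerM hx mulr0 subr0.
by rewrite {1}gE /= map_polyC hornerC => ->.
Qed.

End PrimeExtension.

(** * The Nullstellensatz *)

Lemma rmorph_mpoly_eq (n : nat) (R : comNzRingType) (S : nzRingType)
    (f g : {rmorphism {mpoly R[n]} -> S}) :
  (forall c, f c%:MP = g c%:MP) -> (forall i, f 'X_i = g 'X_i) -> f =1 g.
Proof.
move=> fgC fgX; elim/mpolyind => [|c m p _ _ IHp]; first by rewrite !rmorph0.
rewrite !rmorphD IHp -mul_mpolyC !rmorphM fgC mpolyXE_id !rmorph_prod.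
by congr (_ * _ + _); apply: eq_bigr => i _; rewrite !rmorphXn fgX.
Qed.

(** * Polynomials in n + 1 variables as polynomials in the last one *)

Section UnivariateView.
Variables (n : nat) (R : comNzRingType).

Definition of_uni (q : {poly {mpoly R[n]}}) : {mpoly R[n.+1]} :=
  (map_poly (@mwiden n R) q).['X_ord_max].

Lemma of_uni_is_zmod_morphism : zmod_morphism of_uni.
Proof. by move=> p q; rewrite /of_uni rmorphB hornerD hornerN. Qed.

Lemma of_uni_is_monoid_morphism : monoid_morphism of_uni.
Proof.
split; first by rewrite /of_uni rmorph1 hornerC.
by move=> p q; rewrite /of_uni rmorphM hornerM.
Qed.

HB.instance Definition _ := GRing.isZmodMorphism.Build
  {poly {mpoly R[n]}} {mpoly R[n.+1]} of_uni of_uni_is_zmod_morphism.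
HB.instance Definition _ := GRing.isMonoidMorphism.Build
  {poly {mpoly R[n]}} {mpoly R[n.+1]} of_uni of_uni_is_monoid_morphism.

Lemma muniK : cancel (@muni n R) of_uni.
Proof.
apply: (@rmorph_mpoly_eq _ _ _ (of_uni \o @muni n R) idfun) => [c|i] /=.
  by rewrite muniC /of_uni map_polyC hornerC /= mwidenC.
rewrite muniE msuppX big_seq1 mcoeffX eqxx scale1r /of_uni.
rewrite map_polyZ hornerZ map_polyXn hornerXn /= mwidenX mpolyXn -mpolyXD.
congr 'X_[_]; apply/mnmP => j; rewrite mnmDE mulmnE.
have [jn|] := ltnP j n.
  have -> : j = widen_ord (leqnSn n) (Ordinal jn) by apply: val_inj.
  rewrite mnmwiden_widen mnmE !mnm1E (_ : (ord_max == _) = false) ?addn0 //.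
  by apply/eqP => /(congr1 val) /= nE; rewrite -nE ltnn in jn.
move=> nj; have -> : j = ord_max.
  by apply: val_inj; have := ltn_ord j; rewrite /=; lia.
by rewrite mnmwiden_ordmax !mnm1E eqxx mul1n.
Qed.

Definition extend_point (v : 'I_n -> R) (x : R) (i : 'I_n.+1) : R :=
  if insub (val i) is Some j then v j else x.

Lemma meval_of_uni (v : 'I_n -> R) x q :
  (of_uni q).@[extend_point v x] = (map_poly (meval v) q).[x].
Proof.
have vX : extend_point v x ord_max = x.
  by rewrite /extend_point insubN //= ltnn.
have vw p : (mwiden p).@[extend_point v x] = p.@[v].
  apply: (@rmorph_mpoly_eq _ _ _ (meval (extend_point v x) \o @mwiden n R)
    (meval v)) => [c|i] /=; first by rewrite mwidenC !mevalC.
  rewrite mwidenX mnmwiden1 !mevalXU /extend_point insubT /= => [|ln].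
    exact: ltn_ord.
  by congr v; apply: val_inj.
rewrite /of_uni -horner_map /= mevalXU vX; congr (_.[x]).
by rewrite -map_poly_comp; apply: eq_map_poly.
Qed.

End UnivariateView.

Lemma mpoly0_const (R : comNzRingType) (v : 'I_0 -> R) (p : {mpoly R[0]}) :
  p = (p.@[v])%:MP.
Proof.
apply: (@rmorph_mpoly_eq _ _ _ idfun (@mpolyC 0 R \o meval v)) => [c|[]//] /=.
by rewrite mevalC.
Qed.

Lemma prime_preim (R S : comNzRingType) (f : {rmorphism R -> S})
    (P : S -> Prop) :
  is_prime_ideal P -> is_prime_ideal (fun a => P (f a)).
Proof.
case=> -[P0 PD PM] Pmul; split; first split.
- by rewrite rmorph0.
- by move=> a b; rewrite rmorphD; apply: PD.
- by move=> r a; rewrite rmorphM; apply: PM.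
- by move=> a b; rewrite rmorphM; apply: Pmul.
Qed.

Section Nullstellensatz.
Variable k : closedFieldType.

(** Induction on the number of variables: [prime_extension] yields a polynomial [b] outside the
    contracted prime, and a zero of that prime off [b] lifts. *)
Theorem nullstellensatz_prime n (P : {mpoly k[n]} -> Prop) h :
    is_prime_ideal P -> ~ P h ->
  exists2 v, Vset P v & h.@[v] != 0.
Proof.
elim: n P h => [|n IHn] P h primeP Ph; case: (primeP) => -[P0 PD PM] Pmul.
  pose v (i : 'I_0) : k := 0; exists v => [p Pp|].
    apply/eqP; apply: contra_notT Ph => pv.
    have -> : h = (h * (p.@[v])^-1%:MP) * p.
      rewrite {2}(mpoly0_const v p) -mulrA -mpolyCM mulVf //.
      by rewrite mpolyC1 mulr1.
    exact: PM.
  apply: contra_notN Ph => /eqP hv.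
  by rewrite (mpoly0_const v h) hv mpolyC0.
pose Q q := P (@of_uni n k q).
have primeQ : is_prime_ideal Q := prime_preim _ primeP.
have Qh : ~ Q (muni h) by rewrite /Q muniK.
have [b Qb ext] := prime_extension k primeQ Qh.
have primeP' := prime_preim (@polyC {mpoly k[n]}) primeQ.
have [v Pv bv] := IHn _ _ primeP' Qb.
have [x xP xh] := ext (meval v) Pv bv.
exists (extend_point v x).
  by move=> p Pp; rewrite -[p]muniK meval_of_uni xP // /Q muniK.
by rewrite -[h]muniK meval_of_uni.
Qed.

Lemma in_ideal_is_ideal (R : comNzRingType) n (gs : seq {mpoly R[n]}) :
  is_ideal (in_ideal gs).
Proof.
split.
- by exists (fun=> 0); rewrite big1 // => i _; rewrite mul0r.
- move=> _ _ [c ->] [d ->]; exists (fun i => c i + d i).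
  by rewrite -big_split; apply: eq_bigr => i _; rewrite mulrDl.
- move=> r _ [c ->]; exists (fun i => r * c i).
  by rewrite mulr_sumr; apply: eq_bigr => i _; rewrite mulrA.
Qed.

Lemma mem_in_ideal (R : comNzRingType) n (gs : seq {mpoly R[n]}) g :
  g \in gs -> in_ideal gs g.
Proof.
move=> ggs; have ig : (index g gs < size gs)%N by rewrite index_mem.
exists (fun i => (i == Ordinal ig)%:R).
rewrite (bigD1 (Ordinal ig)) //= eqxx mul1r nth_index // big1 ?addr0 //.
by move=> i /negPf ->; rewrite mul0r.
Qed.

Lemma Vset_in_ideal (R : comNzRingType) n (gs : seq {mpoly R[n]}) v :
  Vset (in_ideal gs) v <-> {in gs, forall g, g.@[v] = 0}.
Proof.
split=> [Vv g /mem_in_ideal /Vv //|gsv _ [c ->]].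
rewrite rmorph_sum big1 // => i _.
by rewrite rmorphM /= (gsv gs`_i) ?mulr0 ?mem_nth.
Qed.

(** If no power of [p] were in the ideal, a prime containing the ideal but not [p] would have a zero
    where [p] is nonzero. *)
Theorem nullstellensatz n (gs : seq {mpoly k[n]}) p :
    (forall v, {in gs, forall g, g.@[v] = 0} -> p.@[v] = 0) ->
  exists e, in_ideal gs (p ^+ e).
Proof.
move=> pV; apply: boolp.contrapT => /boolp.forallNP pe.
have [P [primeP gsP Pp]] := prime_avoiding_powers (in_ideal_is_ideal gs) pe.
have [v Pv /eqP[]] := nullstellensatz_prime primeP Pp.
by apply: pV => g ggs; apply/Pv/gsP/mem_in_ideal.
Qed.

Lemma Vset_sat n (gs : seq {mpoly k[n]}) h v :
  {in gs, forall g, g.@[v] = 0} -> h.@[v] != 0 -> Vset (in_sat gs h) v.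
Proof.
move=> gsv hv p [e he].
have /Vset_in_ideal/(_ _ he) := gsv.
move/eqP; rewrite rmorphM rmorphXn mulf_eq0 expf_eq0 (negPf hv) andbF.
by move/eqP.
Qed.

(** With [Vset_sat], this makes the zero set of the saturation the Zariski closure of the zeros of
    [gs] off [h]. Since [h * p] vanishes on all zeros of [gs], a power of it is in the ideal. *)
Lemma Vset_sat_closure n (gs : seq {mpoly k[n]}) h p v :
    (forall u, {in gs, forall g, g.@[u] = 0} -> h.@[u] != 0 -> p.@[u] = 0) ->
  Vset (in_sat gs h) v -> p.@[v] = 0.
Proof.
move=> pU Vv; have [u gsu|e he] := @nullstellensatz _ gs (h * p).
  rewrite rmorphM /=; have [->|hu] := eqVneq h.@[u] 0; first by rewrite mul0r.
  by rewrite pU ?mulr0.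
have := Vv (p ^+ e); rewrite /in_sat => /(_ (ex_intro _ e _)).
rewrite -exprMn => /(_ he) /eqP; rewrite rmorphXn expf_eq0 => /andP[_].
by move/eqP.
Qed.

End Nullstellensatz.

(** * Isolated zeros *)

Section OrderAtOrigin.
Variables (k : fieldType) (n : nat).
Implicit Types p q : {mpoly k[n]}.

(** Membership in the s-th power of the maximal ideal of the origin. *)
Definition vanish_order s p : Prop := forall a, (mdeg a < s)%N -> p@_a = 0.

Lemma vanish_orderD s p q :
  vanish_order s p -> vanish_order s q -> vanish_order s (p + q).
Proof. by move=> ps qs a sa; rewrite mcoeffD ps // qs // addr0. Qed.

Lemma vanish_orderM s t p q :
  vanish_order s p -> vanish_order t q -> vanish_order (s + t) (p * q).
Proof.
move=> ps qt a sa; rewrite (mcoeff_poly_mul_lin _ _ (leqnn (mdeg a).+1)).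
rewrite big1 // => b /= ba; have [bs|sb] := ltnP (mdeg b) s.
  by rewrite ps ?mul0r.
rewrite [q@__]qt ?mulr0 //.
have : mdeg a = (mdeg b + mdeg (a - b)%MM)%N by rewrite -mdegD addmC submK.
by lia.
Qed.

Lemma vanish_order0 p : vanish_order 0 p. Proof. by []. Qed.

Lemma vanish_orderMl s p q : vanish_order s q -> vanish_order s (p * q).
Proof. exact: (vanish_orderM (vanish_order0 p)). Qed.

Lemma vanish_order_leq s t p : (s <= t)%N -> vanish_order t p -> vanish_order s p.
Proof. by move=> st pt a sa; apply: pt; apply: leq_trans sa st. Qed.

Lemma vanish_orderX s p : vanish_order 1 p -> vanish_order s (p ^+ s).
Proof.
move=> p1; elim: s => [|s IHs]; first exact: vanish_order0.
by rewrite exprS -add1n; apply: vanish_orderM.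
Qed.

Lemma vanish_order_prod r (f : 'I_r -> {mpoly k[n]}) (c : 'I_r -> nat) :
  (forall i, vanish_order 1 (f i)) ->
  vanish_order (\sum_i c i) (\prod_i f i ^+ c i).
Proof.
move=> f1; elim/big_ind2: _ => //.
  by move=> p1 s1 p2 s2; apply: vanish_orderM.
by move=> i _; apply: vanish_orderX.
Qed.

(** Up to scaling, [h] is 1 - w with [w] vanishing at the origin; a truncated geometric series in
    [w] inverts it. *)
Lemma invertible_at_origin s h : h@_0 != 0 ->
  exists h', vanish_order s (1 - h' * h).
Proof.
move=> h0; pose w := 1 - (h@_0)^-1 *: h.
have w1 : vanish_order 1 w.
  move=> a; rewrite ltnS leqn0 mdeg_eq0 => /eqP ->.
  by rewrite mcoeffB mcoeff1 eqxx mcoeffZ mulVf ?subrr.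
exists ((\sum_(i < s) w ^+ i) * (h@_0)^-1%:MP).
rewrite -mulrA mul_mpolyC (_ : _ *: h = 1 - w); last by rewrite /w subKr.
rewrite mulrC -(opprB w) mulNr -subrX1 opprK addrC subrK.
exact: vanish_orderX.
Qed.

End OrderAtOrigin.

(** * Counting monomials at an isolated zero *)

Section LocalDimension.
Variables (k : fieldType) (n : nat) (fs : seq {mpoly k[n]}).
Variables (h : {mpoly k[n]}) (e : nat).
Hypothesis fs0 : {in fs, forall g, g@_0 = 0}.
Hypothesis h0 : h@_0 != 0.
Hypothesis hX : forall i : 'I_n, in_ideal fs (h * 'X_i ^+ e).

Local Notation r := (size fs).

Let f (l : 'I_r) := fs`_l.

Let f1 l : vanish_order 1 (f l).
Proof.
by move=> a; rewrite ltnS leqn0 mdeg_eq0 => /eqP ->; apply: fs0; apply: mem_nth.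
Qed.

Variable s : nat.

Local Notation idx := ({ffun 'I_n -> 'I_e} * {ffun 'I_r -> 'I_s})%type.

Let elt (i : idx) : {mpoly k[n]} :=
  (\prod_j 'X_j ^+ i.1 j) * (\prod_l f l ^+ i.2 l).

Let spanned p := exists c : idx -> k, vanish_order s (p - \sum_i c i *: elt i).

Let spanned0 p : vanish_order s p -> spanned p.
Proof.
move=> ps; exists (fun=> 0); rewrite big1 ?subr0 // => i _.
by rewrite scale0r.
Qed.

Let spannedD p q : spanned p -> spanned q -> spanned (p + q).
Proof.
move=> [c cp] [d dq]; exists (fun i => c i + d i).
have := vanish_orderD cp dq; congr vanish_order.
under [X in _ = _ - X]eq_bigr do rewrite scalerDl.
by rewrite big_split /= opprD addrACA.
Qed.

Let spannedZ c p : spanned p -> spanned (c *: p).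
Proof.
move=> [d dp]; exists (fun i => c * d i).
have := vanish_orderMl c%:MP dp; congr vanish_order.
rewrite mul_mpolyC scalerBr scaler_sumr; congr (_ - _).
by apply: eq_bigr => i _; rewrite scalerA.
Qed.

Let spanned_sum (T : Type) (t : seq T) (F : T -> {mpoly k[n]}) :
  (forall i, spanned (F i)) -> spanned (\sum_(i <- t) F i).
Proof.
by move=> Fs; elim/big_ind: _ => //; apply: spanned0 => a _; rewrite mcoeff0.
Qed.

(** Induction on [j], a bound on the number of factors from [fs] still missing to reach order [s]. A
    monomial with all exponents below [e] gives an [elt]; in any other one, some X_i^e is traded for
    a combination of [fs], [h] being invertible modulo order [s], and this gains a factor. *)
Let spanned_power (j : nat) (c : 'I_r -> nat) q :
  (s <= j + \sum_l c l)%N -> spanned (\prod_l f l ^+ c l * q).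
Proof.
have [h' hh'] := invertible_at_origin s h0.
elim: j c q => [|j IHj] c q sj.
  apply: spanned0; rewrite mulrC; apply: vanish_orderMl.
  by apply: vanish_order_leq sj _; apply: vanish_order_prod.
rewrite [q]mpolyE mulr_sumr; apply: spanned_sum => a.
rewrite -scalerAr; apply: spannedZ.
have [sc|cs] := leqP s (\sum_l c l).
  by apply: IHj; apply: leq_trans sc _; rewrite leq_addl.
have cs' l : (c l < s)%N.
  by apply: leq_ltn_trans cs; rewrite (bigD1 l) //= leq_addr.
have [/forallP ae|] := boolP [forall i, a i < e]%N.
  pose i0 : idx := ([ffun i => Ordinal (ae i)], [ffun l => Ordinal (cs' l)]).
  exists (fun i => (i == i0)%:R); rewrite (bigD1 i0) //= eqxx scale1r.
  rewrite [X in elt i0 + X]big1 => [|i /negPf ->]; last by rewrite scale0r.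
  rewrite addr0 mulrC (_ : _ * _ = elt i0) ?subrr.
    by move=> b _; rewrite mcoeff0.
  by rewrite /elt mpolyXE_id; congr (_ * _); apply: eq_bigr => i _; rewrite ffunE.
rewrite negb_forall => /existsP[i]; rewrite -leqNgt => ei.
have [d hd] := hX i.
have -> : 'X_[a] = 'X_i ^+ e * 'X_[a - U_(i) *+ e] :> {mpoly k[n]}.
  rewrite mpolyXn -mpolyXD addmC submK //; apply/mnm_lepP => l.
  by rewrite mulmnE mnm1E; case: eqVneq => [<-|_]; rewrite ?mul1n ?mul0n.
set b := 'X_[a - _].
have -> : \prod_l f l ^+ c l * ('X_i ^+ e * b) =
    \prod_l f l ^+ c l * ('X_i ^+ e * b) * (1 - h' * h)
    + \prod_l f l ^+ c l * (h' * b) * (h * 'X_i ^+ e) by ring.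
apply: spannedD; first exact/spanned0/vanish_orderMl.
rewrite hd mulr_sumr; apply: spanned_sum => l.
have -> : \prod_l f l ^+ c l * (h' * b) * (d l * fs`_l) =
    \prod_l' f l' ^+ (c l' + (l' == l))%N * (h' * b * d l).
  have fl : \prod_l' f l' ^+ (l' == l) = fs`_l.
    rewrite (bigD1 l) //= eqxx expr1 big1 ?mulr1 // => l' /negPf -> //.
  under [in RHS]eq_bigr do rewrite exprD.
  by rewrite big_split /= fl; ring.
apply: IHj; rewrite big_split /= [X in (_ + (_ + X))%N](bigD1 l) //= eqxx addnCA.
by apply: leq_trans sj _; rewrite addnC leq_add2l add1n addnS ltnS leq_addr.
Qed.

Let spanned_all p : spanned p.
Proof.
have := @spanned_power s (fun=> 0%N) p; rewrite [X in spanned (X * _)]big1 // mul1r.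
by apply; rewrite leq_addr.
Qed.

(** Monomials of degree below [s] are independent modulo order [s], and each is a combination of the
    [elt]. So the matrix [M] of coefficients has full column rank, which its number of rows
    bounds. *)
Lemma card_bmultinom_le : (#|{: 'X_{1..n < s}}| <= e ^ n * s ^ r)%N.
Proof.
pose ei (i : 'I_#|{: idx}|) : idx := enum_val i.
pose ej (j : 'I_#|{: 'X_{1..n < s}}|) : 'X_{1..n < s} := enum_val j.
have ejI : injective ej by apply: enum_val_inj.
pose M := \matrix_(i, j) (elt (ei i))@_(ej j).
have sub : (1%:M <= M)%MS.
  apply/row_subP => j; apply/submxP.
  have [c cs] := spanned_all 'X_[ej j].
  exists (\row_i c (ei i)); apply/rowP => j'.
  have := cs (ej j') (bmdeg _).
  rewrite mcoeffB mcoeffX => /eqP; rewrite subr_eq0 -bmeqP (inj_eq ejI) => /eqP.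
  rewrite !mxE eq_sym => ->.
  rewrite raddf_sum (reindex ei) /=; last exact: onW_bij (enum_val_bij _).
  by apply: eq_bigr => i _; rewrite !mxE mcoeffZ.
have := mxrankS sub; rewrite mxrank1 => /leq_trans; apply.
apply: leq_trans (rank_leq_row _) _.
by rewrite card_prod !card_ffun !card_ord.
Qed.

End LocalDimension.

(* A Hilbert-Samuel estimate: modulo the [s]-th power of the maximal ideal, the
   local ring has dimension at least [(s / n) ^ n], but the monomials in the
   [f]'s and the bounded monomials in the variables span it. *)
Lemma local_dimension_le (k : fieldType) n (fs : seq {mpoly k[n]}) h e :
    {in fs, forall g, g@_0 = 0} -> h@_0 != 0 ->
    (forall i : 'I_n, in_ideal fs (h * 'X_i ^+ e)) ->
  (n <= size fs)%N.
Proof.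
move=> fs0 h0 hX; rewrite leqNgt; apply/negP => rn.
(* Put s = n c and r = size fs. There are at least c^n >= c^(r+1) monomials, and [c] is just large
   enough for c^(r+1) to exceed e^n (n c)^r. *)
pose c := (e ^ n * n ^ size fs).+1.
have := card_bmultinom_le fs0 h0 hX (n * c); apply/negP; rewrite -ltnNge.
have inj : (c ^ n <= #|{: 'X_{1..n < n * c}}|)%N.
  have lt (a : {ffun 'I_n -> 'I_c}) :
      (mdeg [multinom (a i : nat) | i < n] < n * c)%N.
    apply: (@leq_ltn_trans (n * c.-1)); last first.
      by rewrite ltn_pmul2l ?ltnSn //; apply: leq_ltn_trans rn.
    have -> : (n * c.-1 = \sum_(i < n) c.-1)%N by rewrite sum_nat_const card_ord.
    by rewrite mdegE leq_sum // => i _; rewrite mnmE -ltnS ltn_ord.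
  rewrite -[X in (X ^ _ <= _)%N]card_ord -[X in (_ ^ X <= _)%N]card_ord -card_ffun.
  apply: (@leq_card _ _ (fun a => BMultinom (lt a))) => a b /(congr1 val) /= ab.
  apply/ffunP => i; apply: val_inj.
  by have := congr1 (fun m : 'X_{1..n} => m i) ab; rewrite !mnmE.
apply: leq_trans inj.
apply: (@leq_trans (c ^ (size fs).+1)); last by rewrite leq_pexp2l.
by rewrite expnMn mulnA expnS ltn_pmul2r ?expn_gt0.
Qed.

Section Translation.
Variables (R : comNzRingType) (n : nat) (v : 'I_n -> R).

Definition translate (p : {mpoly R[n]}) : {mpoly R[n]} :=
  p \mPo [tuple 'X_i + (v i)%:MP | i < n].

Lemma meval_translate u p : (translate p).@[u] = p.@[fun i => u i + v i].
Proof.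
rewrite /translate comp_mpoly_meval; apply: meval_eq => i.
by rewrite tnth_map tnth_ord_tuple /= mevalD mevalXU mevalC.
Qed.

End Translation.

Lemma meval_origin (R : comNzRingType) n (p : {mpoly R[n]}) :
  p.@[fun=> 0] = p@_0.
Proof.
elim/mpolyind: p => [|c a p _ _ IHp]; first by rewrite meval0 mcoeff0.
rewrite mevalD mevalZ mevalX mcoeffD mcoeffZ mcoeffX IHp; congr (_ * _ + _).
have [->|a0] := eqVneq; first by rewrite big1 // => i _; rewrite mnm0E.
have [i ai] : exists i, a i != 0%N.
  apply/existsP; rewrite -negb_forall; apply: contraNN a0 => /forallP a0.
  by apply/eqP/mnmP => i; rewrite mnm0E (eqP (a0 i)).
by rewrite (bigD1 i) //= expr0n (negPf ai) mul0r.
Qed.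

(** After translating [v] to the origin, each h X_i vanishes on all zeros of [fs], so a power of it
    is in the ideal; as [h] is nonzero at the origin, the local count applies. *)
Theorem isolated_zero_dimension (k : closedFieldType) n
    (fs : seq {mpoly k[n]}) h v :
    {in fs, forall g, g.@[v] = 0} -> h.@[v] != 0 ->
    (forall u, {in fs, forall g, g.@[u] = 0} -> h.@[u] != 0 -> u =1 v) ->
  (n <= size fs)%N.
Proof.
move=> fsv hv iso; rewrite -(size_map (translate v)).
have fsT u : {in map (translate v) fs, forall g, g.@[u] = 0} ->
    {in fs, forall g, g.@[fun i => u i + v i] = 0}.
  by move=> fsu g gfs; rewrite -meval_translate; apply/fsu/map_f.
have hXe (i : 'I_n) : exists e, in_ideal (map (translate v) fs)
    ((translate v h * 'X_i) ^+ e).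
  apply: nullstellensatz => u /fsT fsu; rewrite mevalM mevalXU meval_translate.
  have [->|hu] := eqVneq h.@[fun i => u i + v i] 0; first by rewrite mul0r.
  have := iso _ fsu hu i; rewrite -[X in _ = X]add0r => /addIr ->.
  by rewrite mulr0.
have [e he] := boolp.choice hXe.
pose E := \max_i e i.
have T0 p : (translate v p)@_0 = p.@[v].
  by rewrite -meval_origin meval_translate; apply: meval_eq => i; rewrite add0r.
apply: (@local_dimension_le _ _ _ (translate v h ^+ E) E) => [g||].
- by case/mapP => p pfs ->; rewrite T0 fsv.
- by rewrite -meval_origin rmorphXn expf_eq0 /= meval_origin T0 (negPf hv) andbF.
- move=> i; rewrite -exprMn -(subnK (leq_bigmax i : e i <= E)%N) exprD.
  by have [_ _ IM] := in_ideal_is_ideal (map (translate v) fs); apply: IM.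
Qed.

(** * Regular functions and irreducible loci *)

Section RegularFunctions.
Variables (k : closedFieldType) (n : nat) (h : {mpoly k[n]}).
Implicit Types (F : ('I_n -> k) -> k) (p : {mpoly k[n]}).

(** An element of the localization at [h], seen as a function with denominators cleared. Values
    where [h] vanishes are unconstrained. *)
Definition regular_off F : Prop := exists e p,
  forall w, h.@[w] != 0 -> h.@[w] ^+ e * F w = p.@[w].

Lemma regular_ext F1 F2 :
  (forall w, h.@[w] != 0 -> F1 w = F2 w) -> regular_off F1 -> regular_off F2.
Proof.
by move=> F12 [e [p Fp]]; exists e, p => w hw; rewrite -F12 // Fp.
Qed.

Lemma regular_const c : regular_off (fun=> c).
Proof. by exists 0%N, c%:MP => w _; rewrite expr0 mul1r mevalC. Qed.

Lemma regular_var i : regular_off (fun w => w i).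
Proof. by exists 0%N, 'X_i => w _; rewrite expr0 mul1r mevalXU. Qed.

Lemma regular_invh : regular_off (fun w => (h.@[w])^-1).
Proof. by exists 1%N, 1 => w hw; rewrite expr1 mulfV ?meval1. Qed.

Lemma regularD F1 F2 :
  regular_off F1 -> regular_off F2 -> regular_off (fun w => F1 w + F2 w).
Proof.
move=> [e [p Fp]] [d [q Fq]]; exists (e + d)%N, (h ^+ d * p + h ^+ e * q).
move=> w hw; rewrite mevalD !mevalM !rmorphXn /= -Fp // -Fq //.
by rewrite exprD; ring.
Qed.

Lemma regularM F1 F2 :
  regular_off F1 -> regular_off F2 -> regular_off (fun w => F1 w * F2 w).
Proof.
move=> [e [p Fp]] [d [q Fq]]; exists (e + d)%N, (p * q).
by move=> w hw; rewrite mevalM -Fp // -Fq // exprD; ring.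
Qed.

Lemma regularN F : regular_off F -> regular_off (fun w => - F w).
Proof.
move=> /(regularM (regular_const (-1))); apply: regular_ext => w _.
by rewrite mulN1r.
Qed.

Lemma regularX F e : regular_off F -> regular_off (fun w => F w ^+ e).
Proof.
move=> FR; elim: e => [|e IHe].
  by apply: regular_ext (regular_const 1) => w _; rewrite expr0.
by apply: regular_ext (regularM FR IHe) => w _; rewrite exprS.
Qed.

Lemma regular_sum (I : Type) (t : seq I) (F : I -> ('I_n -> k) -> k) :
  (forall i, regular_off (F i)) -> regular_off (fun w => \sum_(i <- t) F i w).
Proof.
move=> FR; elim: t => [|i t IHt].
  by apply: regular_ext (regular_const 0) => w _; rewrite big_nil.
by apply: regular_ext (regularD (FR i) IHt) => w _; rewrite big_cons.
Qed.

Lemma regular_comp n' (phi : ('I_n -> k) -> 'I_n' -> k) (p : {mpoly k[n']}) :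
  (forall i, regular_off (fun w => phi w i)) ->
  regular_off (fun w => p.@[phi w]).
Proof.
move=> phiR; elim/mpolyind: p => [|c a p _ _ IHp].
  by apply: regular_ext (regular_const 0) => w _; rewrite meval0.
have monR : regular_off (fun w => \prod_i phi w i ^+ a i).
  elim: (index_enum _) => [|i t IHt].
    by apply: regular_ext (regular_const 1) => w _; rewrite big_nil.
  apply: regular_ext (regularM (regularX (a i) (phiR i)) IHt) => w _.
  by rewrite big_cons.
apply: regular_ext (regularD (regularM (regular_const c) monR) IHp) => w _.
by rewrite mevalD mevalZ mevalX.
Qed.

Definition regular_poly (P : ('I_n -> k) -> {poly k}) : Prop :=
  forall i, regular_off (fun w => (P w)`_i).

Lemma regular_polyD P Q :
  regular_poly P -> regular_poly Q -> regular_poly (fun w => P w + Q w).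
Proof.
move=> PR QR i; apply: regular_ext (regularD (PR i) (QR i)) => w _.
by rewrite coefD.
Qed.

Lemma regular_polyM P Q :
  regular_poly P -> regular_poly Q -> regular_poly (fun w => P w * Q w).
Proof.
move=> PR QR i.
have := @regular_sum _ (index_enum 'I_i.+1) _
  (fun j : 'I_i.+1 => regularM (PR j) (QR (i - j)%N)).
by apply: regular_ext => w _; rewrite coefM.
Qed.

End RegularFunctions.

Section IrreducibleLoci.
Variable k : closedFieldType.

Lemma mpoly_nonvanishing n (p : {mpoly k[n]}) :
  p != 0 -> exists w, p.@[w] != 0.
Proof.
move=> p0; apply: boolp.contrapT => /boolp.forallNP pV.
have [v _|e [c]] := @nullstellensatz k n [::] p.
  by apply/eqP; apply: contra_notT (pV v).
by rewrite big_ord0 => /eqP; rewrite expf_eq0 (negPf p0) andbF.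
Qed.

Definition nonvanishing_on n (A : ('I_n -> k) -> Prop) (p : {mpoly k[n]}) :=
  exists2 v, A v & p.@[v] != 0.

(** Irreducibility tested on principal open subsets; it is meant for loci that are not closed. *)
Definition irreducible_locus n (A : ('I_n -> k) -> Prop) : Prop :=
  forall b c, nonvanishing_on A b -> nonvanishing_on A c ->
  nonvanishing_on A (b * c).

(** Pulled back along [phi], [b] and [c] become p / h^e and q / h^d with [p] and [q] nonzero. So h p
    q is nonzero at some parameter, and b c at its image. *)
Lemma parametrised_irreducible n n' (A : ('I_n -> k) -> Prop)
    (h : {mpoly k[n']}) (phi : ('I_n' -> k) -> 'I_n -> k) :
    (forall i, regular_off h (fun w => phi w i)) ->
    (forall w, h.@[w] != 0 -> A (phi w)) ->
    (forall v, A v -> exists2 w, h.@[w] != 0 & v =1 phi w) ->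
  irreducible_locus A.
Proof.
move=> phiR phiA phi_surj b c [u Au bu] [v Av cv].
have [e [p bp]] := regular_comp b phiR.
have [d [q cq]] := regular_comp c phiR.
have [[w hw uw] [w' hw' vw']] := (phi_surj u Au, phi_surj v Av).
have p0 : p != 0.
  apply: contraNneq bu => p0; have := bp w hw.
  rewrite p0 meval0 -(meval_eq _ uw) => /eqP.
  by rewrite mulf_eq0 expf_eq0 (negPf hw) andbF.
have q0 : q != 0.
  apply: contraNneq cv => q0; have := cq w' hw'.
  rewrite q0 meval0 -(meval_eq _ vw') => /eqP.
  by rewrite mulf_eq0 expf_eq0 (negPf hw') andbF.
have h0 : h != 0 by apply: contraNneq hw => ->; rewrite meval0.
have [x] := mpoly_nonvanishing (mulf_neq0 h0 (mulf_neq0 p0 q0)).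
rewrite !mevalM !mulf_eq0 !negb_or => /and3P[hx px qx].
exists (phi x); first exact: phiA.
rewrite mevalM mulf_neq0 //.
  by apply: contraNneq px => bx; rewrite -bp // bx mulr0.
by apply: contraNneq qx => cx; rewrite -cq // cx mulr0.
Qed.

(** [A] is dense in [Z]. A closed set not containing [Z] lies in the zeros of a polynomial that is
    nonzero somewhere on [A], and two such sets cannot cover [A]. *)
Lemma zirreducible_closure n (A Z : ('I_n -> k) -> Prop) :
    (exists v, A v) -> (forall v, A v -> Z v) ->
    (forall p v, Z v -> p.@[v] != 0 -> nonvanishing_on A p) ->
    irreducible_locus A -> zirreducible Z.
Proof.
move=> [v0 Av0] AZ ZA irrA; split; first by exists v0; apply: AZ.
have notB (B : ('I_n -> k) -> Prop) (I : {mpoly k[n]} -> Prop) :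
    (forall v, B v <-> Vset I v) -> ~ (forall v, Z v -> B v) ->
    exists2 b, nonvanishing_on A b & forall v, B v -> b.@[v] = 0.
  move=> BI /boolp.existsNP[v /boolp.not_implyP[Zv Bv]].
  have [b [Ib bv]] : exists b, I b /\ b.@[v] <> 0.
    apply: boolp.contrapT => nob; apply/Bv/BI => b Ib.
    by apply: boolp.contrapT => bv; apply: nob; exists b.
  exists b; first by apply: ZA Zv _; apply/eqP.
  by move=> u /BI; apply.
move=> B C [I BI] [J CJ] ZBC; apply: boolp.contrapT.
move=> /boolp.not_orP[/(notB _ _ BI)[b bA bB] /(notB _ _ CJ)[c cA cC]].
have [v Av /eqP[]] := irrA b c bA cA; rewrite mevalM.
by case: (ZBC v (AZ v Av)) => [/bB|/cC] ->; rewrite ?mul0r ?mulr0.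
Qed.

End IrreducibleLoci.

(** * Orders of vanishing in t *)

Section LowOrder.
Variable R : comNzRingType.
Implicit Types (p q x y z : {poly R}) (r s : nat).

Definition low r p : Prop := forall i, (i < r)%N -> p`_i = 0.

Lemma lowW r s p : (s <= r)%N -> low r p -> low s p.
Proof. by move=> sr pr i si; apply: pr; apply: leq_trans si sr. Qed.

Lemma lowM r s p q : low r p -> low s q -> low (r + s) (p * q).
Proof.
move=> pr qs i irs; rewrite coefM big1 // => j _.
have [jr|rj] := ltnP j r; first by rewrite pr ?mul0r.
by rewrite [q`__]qs ?mulr0 //; have := ltn_ord j; lia.
Qed.

Lemma coefM_low r s p q : low r p -> low s q -> (p * q)`_(r + s) = p`_r * q`_s.
Proof.
move=> pr qs; have rlt : (r < (r + s).+1)%N by rewrite ltnS leq_addr.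
rewrite coefM (bigD1 (Ordinal rlt)) //= addKn big1 ?addr0 // => j.
rewrite -val_eqE /= => jr; have [jr'|rj] := ltnP j r; first by rewrite pr ?mul0r.
by rewrite [q`__]qs ?mulr0 //; have := ltn_ord j; lia.
Qed.

Definition gpoly x y z : {poly R} :=
  x ^+ 2 + y ^+ 2 * z + y * z ^+ 2 + x * y * z.

Lemma gpolyC x y z : gpoly x y z = gpoly x z y.
Proof. by rewrite /gpoly; ring. Qed.

Lemma gpoly_low r x y z l : low r.+1 x -> low r y -> low r z ->
  (l < 3 * r)%N -> (gpoly x y z)`_l = (x ^+ 2)`_l.
Proof.
move=> xr yr zr lr.
have yyz : low (r + r + r) (y ^+ 2 * z) by rewrite expr2; do !apply: lowM.
have yzz : low (r + (r + r)) (y * z ^+ 2) by rewrite expr2; do !apply: lowM.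
have xyz : low (r.+1 + r + r) (x * y * z) by do !apply: lowM.
by rewrite /gpoly !coefD yyz ?yzz ?xyz ?addr0 //; lia.
Qed.

Lemma gpoly_coef3 r x y z : low r.+1 x -> low r y -> low r z ->
  (gpoly x y z)`_(3 * r) = (x ^+ 2)`_(3 * r) + y`_r * z`_r * (y`_r + z`_r).
Proof.
move=> xr yr zr.
have yyz : (y ^+ 2 * z)`_(3 * r) = y`_r * y`_r * z`_r.
  rewrite (_ : 3 * r = r + r + r)%N; last by lia.
  by rewrite expr2 (coefM_low (lowM yr yr) zr) (coefM_low yr yr).
have yzz : (y * z ^+ 2)`_(3 * r) = y`_r * (z`_r * z`_r).
  rewrite (_ : 3 * r = r + (r + r))%N; last by lia.
  by rewrite expr2 (coefM_low yr (lowM zr zr)) (coefM_low zr zr).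
have xyz : low (r.+1 + r + r) (x * y * z) by do !apply: lowM.
by rewrite /gpoly !coefD yyz yzz xyz; [ring|lia].
Qed.

Hypothesis R2 : (2 \in [pchar R])%N.

(** Split [y] into its part [u] below t^j and the rest [d]. The cross term 2 u d z vanishes in
    characteristic 2, and d^2 z and x d z have order above j + 2r; only d z^2 contributes. *)
Lemma gpoly_linear r j x y z :
    low r.+1 x -> low r z -> (r < j)%N ->
  (gpoly x y z)`_(j + 2 * r) =
    z`_r ^+ 2 * y`_j + (gpoly x (take_poly j y) z)`_(j + 2 * r).
Proof.
move=> xr zr rj; set u := take_poly j y; pose d := y - u.
have dj : low j d by move=> i ij; rewrite coefB coef_take_poly ij subrr.
have djE : d`_j = y`_j by rewrite coefB coef_take_poly ltnn subr0.
have two0 : 2%:R = 0 :> {poly R} by rewrite -polyC_natr (pcharf0 R2) polyC0.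
have -> : gpoly x y z = gpoly x u z + (d * d * z + d * (z * z) + x * d * z)
    + 2%:R * (u * d * z).
  by rewrite (_ : y = u + d) /gpoly; [ring|rewrite addrC subrK].
rewrite two0 mul0r addr0 !coefD (lowM (lowM dj dj) zr); last by lia.
rewrite (lowM (lowM xr dj) zr); last by lia.
rewrite (_ : j + 2 * r = j + (r + r))%N; last by lia.
by rewrite (coefM_low dj (lowM zr zr)) (coefM_low zr zr) djE; ring.
Qed.

End LowOrder.

(** * Jets *)

Section Solve.
Variables (k : fieldType) (m r : nat) (x z : {poly k}) (b : nat -> k).

(** By [gpoly_linear], the equation at t^(j+2r), available when j + 2r <= m, fixes y_j; the other
    coefficients are prescribed by [b]. *)
Definition determined j : bool := ((r < j) && (j + 2 * r <= m))%N.

(** [solve j] is the truncation of the solution below t^j, so each coefficient is computed from the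
    preceding ones. *)
Fixpoint solve (j : nat) : {poly k} :=
  if j is i.+1 then
    solve i + (if determined i
               then - (gpoly x (solve i) z)`_(i + 2 * r) / z`_r ^+ 2
               else b i) *: 'X^i
  else 0.

Lemma size_solve j : (size (solve j) <= j)%N.
Proof.
elim: j => [|j IHj] /=; first by rewrite size_poly0.
apply: leq_trans (size_polyD _ _) _; rewrite geq_max (leq_trans IHj) //=.
by apply: leq_trans (size_scale_leq _ _) _; rewrite size_polyXn.
Qed.

Lemma coef_solveS j : (solve j.+1)`_j =
  if determined j then - (gpoly x (solve j) z)`_(j + 2 * r) / z`_r ^+ 2 else b j.
Proof.
rewrite /= coefD coefZ coefXn eqxx mulr1 nth_default ?add0r //.
exact: size_solve.
Qed.

Lemma take_solveS j : take_poly j (solve j.+1) = solve j.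
Proof.
apply/polyP => i; rewrite coef_take_poly /= coefD coefZ coefXn.
case: ltngtP => [ij|ij|->]; rewrite ?mulr0 ?addr0 //.
  by rewrite nth_default // (leq_trans (size_solve j)) ?(ltnW ij).
by rewrite nth_default // size_solve.
Qed.

Lemma take_solve i j : (i <= j)%N -> take_poly i (solve j) = solve i.
Proof.
move=> ij; rewrite -(subnKC ij); elim: (j - i)%N => [|d IHd].
  by rewrite addn0 take_poly_id // size_solve.
rewrite addnS -[RHS]IHd -(take_solveS (i + d)); apply/polyP => l.
by rewrite !coef_take_poly; case: ifP => // li; rewrite ifT //; lia.
Qed.

Lemma coef_solve i j : (i < j)%N -> (solve j)`_i =
  if determined i then - (gpoly x (solve i) z)`_(i + 2 * r) / z`_r ^+ 2 else b i.
Proof.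
by move=> ij; rewrite -coef_solveS -(take_solve ij) coef_take_poly leqnn.
Qed.

Hypothesis k2 : (2 \in [pchar k])%N.
Hypotheses (xr : low r.+1 x) (zr : low r z) (zr0 : z`_r != 0).

Lemma solveP l : (3 * r < l <= m)%N -> (gpoly x (solve m.+1) z)`_l = 0.
Proof.
move=> /andP[rl lm]; pose j := (l - 2 * r)%N.
have lE : l = (j + 2 * r)%N by rewrite /j; lia.
have rj : (r < j)%N by rewrite /j; lia.
rewrite lE (gpoly_linear k2) // take_solve ?coef_solve ?ltnS; [|lia..].
rewrite /determined rj -lE lm /= mulrC divfK ?expf_neq0 //.
by rewrite addrC subrr.
Qed.

Lemma solve_unique (y : {poly k}) : (size y <= m.+1)%N ->
    (forall l, (3 * r < l <= m)%N -> (gpoly x y z)`_l = 0) ->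
    (forall j, (j <= m)%N -> ~~ determined j -> y`_j = b j) ->
  y = solve m.+1.
Proof.
move=> ym yg yb; rewrite -[y in LHS](@take_poly_id _ m.+1) //.
elim: {-2}m.+1 (leqnn m.+1) => [_|j IHj jm]; first by rewrite take_poly0l.
apply/polyP => i; have {}IHj := IHj (ltnW jm).
have coefj i' : (take_poly j.+1 y)`_i' =
    (take_poly j y)`_i' + (if i' == j then y`_j else 0).
  rewrite !coef_take_poly; case: (ltngtP i' j) => [ij|ij|->].
  - by rewrite ltnS (ltnW ij) addr0.
  - by rewrite ltnS leqNgt ij addr0.
  - by rewrite ltnSn add0r.
rewrite coefj IHj /= coefD coefZ coefXn; congr (_ + _).
case: eqP => _; last by rewrite mulr0.
rewrite mulr1; case: ifPn => [/andP[rj jr]|/yb -> //].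
apply: (mulfI (expf_neq0 2 zr0)); rewrite [RHS]mulrC divfK ?expf_neq0 //.
apply/eqP; rewrite -addr_eq0 -IHj -(gpoly_linear k2) // yg //; lia.
Qed.

End Solve.

Lemma regular_solve (k : closedFieldType) n (h : {mpoly k[n]}) m r
    (x z : ('I_n -> k) -> {poly k}) (b : ('I_n -> k) -> nat -> k) j :
    regular_poly h x -> regular_poly h z ->
    (forall i, regular_off h (fun w => b w i)) ->
    regular_off h (fun w => ((z w)`_r)^-1) ->
  regular_poly h (fun w => solve m r (x w) (z w) (b w) j).
Proof.
move=> xR zR bR zrR; elim: j => [|j IHj] /=.
  by move=> i; apply: regular_ext (regular_const h 0) => w _; rewrite coef0.
apply: regular_polyD => // i.
have gR : regular_poly h
    (fun w => gpoly (x w) (solve m r (x w) (z w) (b w) j) (z w)).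
  rewrite /gpoly; do !apply: regular_polyD; do !apply: regular_polyM => //.
have cR : regular_off h (fun w => (if determined m r j
    then - (gpoly (x w) (solve m r (x w) (z w) (b w) j) (z w))`_(j + 2 * r)
         / (z w)`_r ^+ 2 else b w j) * (i == j)%:R).
  apply: regularM; last exact: regular_const.
  case: (determined m r j) => //; apply: regularM; first exact: regularN.
  by apply: regular_ext (regularX 2 zrR) => w _; rewrite exprVn.
by apply: regular_ext cR => w _; rewrite coefZ coefXn.
Qed.

(** * Points of the jet space as triples of polynomials *)

Section JetPoints.
Variables (k : closedFieldType) (m : nat).
Local Notation point := ('I_(NV m) -> k).
Implicit Types (v w : point) (x y z : {poly k}).

Definition ix (i : nat) : 'I_(NV m) := lshift m.+1 (lshift m.+1 (@inord m i)).
Definition iy (i : nat) : 'I_(NV m) := lshift m.+1 (rshift m.+1 (@inord m i)).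
Definition iz (i : nat) : 'I_(NV m) := rshift (m.+1 + m.+1) (@inord m i).

(* The equation is symmetric in [y] and [z]; the flag [s] exchanges their roles. *)
Definition iY (s : bool) := if s then iz else iy.
Definition iZ (s : bool) := if s then iy else iz.

Definition jet (f : nat -> k) : {poly k} := \poly_(i < m.+1) f i.

Definition jx v := jet (fun i => v (ix i)).
Definition jY s v := jet (fun i => v (iY s i)).
Definition jZ s v := jet (fun i => v (iZ s i)).

Lemma size_jet f : (size (jet f) <= m.+1)%N.
Proof. exact: size_poly. Qed.

Lemma coef_jet f i : (i <= m)%N -> (jet f)`_i = f i.
Proof. by move=> im; rewrite coef_poly ltnS im. Qed.

Definition on_jets v : Prop :=
  forall j, (j <= m)%N -> (gpoly (jx v) (jY false v) (jZ false v))`_j = 0.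

Lemma on_jetsE s v j :
  (gpoly (jx v) (jY false v) (jZ false v))`_j = (gpoly (jx v) (jY s v) (jZ s v))`_j.
Proof. by case: s => //; rewrite gpolyC. Qed.

Lemma meval_gj v j :
  (gj k m j).@[v] = (gpoly (jx v) (jY false v) (jZ false v))`_j.
Proof.
rewrite /gj -coef_map; congr (_`_j).
have jetE (f : nat -> {mpoly k[NV m]}) :
    map_poly (meval v) (\poly_(i < m.+1) f i) = jet (fun i => (f i).@[v]).
  apply/polyP => i; rewrite coef_map !coef_poly.
  by case: ifP => _ /=; rewrite ?meval0.
have jetX (ii : nat -> 'I_(NV m)) :
    jet (fun i => ('X_(ii i)).@[v]) = jet (fun i => v (ii i)).
  by rewrite /jet; apply/polyP => i; rewrite !coef_poly mevalXU.
by rewrite !(rmorphD, rmorphXn, rmorphM) /= !jetE !jetX.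
Qed.

Lemma gens_gP v : {in gens_g k m, forall g, g.@[v] = 0} <-> on_jets v.
Proof.
split=> [gv j jm|gv _ /mapP[j jm ->]].
  by rewrite -meval_gj; apply/gv/map_f; rewrite mem_iota.
by rewrite meval_gj gv //; move: jm; rewrite mem_iota add0n.
Qed.

Definition mkpoint (x y z : {poly k}) : point := fun t =>
  match split t with
  | inl t1 => match split t1 with inl i => x`_i | inr i => y`_i end
  | inr i => z`_i
  end.

Definition mk s (x y z : {poly k}) : point :=
  if s then mkpoint x z y else mkpoint x y z.

Lemma mkpoint_ix x y z i : (i <= m)%N -> mkpoint x y z (ix i) = x`_i.
Proof.
by move=> im; rewrite /mkpoint (unsplitK (inl _)) (unsplitK (inl _)) inordK.
Qed.

Lemma mkpoint_iy x y z i : (i <= m)%N -> mkpoint x y z (iy i) = y`_i.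
Proof.
by move=> im; rewrite /mkpoint (unsplitK (inl _)) (unsplitK (inr _)) inordK.
Qed.

Lemma mkpoint_iz x y z i : (i <= m)%N -> mkpoint x y z (iz i) = z`_i.
Proof. by move=> im; rewrite /mkpoint (unsplitK (inr _)) inordK. Qed.

Lemma jet_coefK (x : {poly k}) (f : nat -> k) : (size x <= m.+1)%N ->
  (forall i, (i <= m)%N -> f i = x`_i) -> jet f = x.
Proof.
move=> xm fx; apply/polyP => i; rewrite coef_poly ltnS.
by case: leqP => [/fx //|im]; rewrite nth_default // (leq_trans xm).
Qed.

Lemma mk_ix s x y z i : (i <= m)%N -> mk s x y z (ix i) = x`_i.
Proof. by case: s; apply: mkpoint_ix. Qed.

Lemma mk_iY s x y z i : (i <= m)%N -> mk s x y z (iY s i) = y`_i.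
Proof. by case: s; [apply: mkpoint_iz|apply: mkpoint_iy]. Qed.

Lemma mk_iZ s x y z i : (i <= m)%N -> mk s x y z (iZ s i) = z`_i.
Proof. by case: s; [apply: mkpoint_iy|apply: mkpoint_iz]. Qed.

Lemma jx_mk s x y z : (size x <= m.+1)%N -> jx (mk s x y z) = x.
Proof. by move=> xm; apply: jet_coefK => // i; apply: mk_ix. Qed.

Lemma jY_mk s x y z : (size y <= m.+1)%N -> jY s (mk s x y z) = y.
Proof. by move=> ym; apply: jet_coefK => // i; apply: mk_iY. Qed.

Lemma jZ_mk s x y z : (size z <= m.+1)%N -> jZ s (mk s x y z) = z.
Proof. by move=> zm; apply: jet_coefK => // i; apply: mk_iZ. Qed.

Lemma mk_jets s v : v =1 mk s (jx v) (jY s v) (jZ s v).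
Proof.
move=> t; rewrite -[t]splitK; case: (split t) => [t1|i] /=.
  rewrite -[t1]splitK; case: (split t1) => [i|i] /=.
    have -> : lshift m.+1 (lshift m.+1 i) = ix i by rewrite /ix inord_val.
    have im : (i <= m)%N by rewrite -ltnS ltn_ord.
    by rewrite /mk; case: s; rewrite mkpoint_ix // coef_jet.
  have -> : lshift m.+1 (rshift m.+1 i) = iy i by rewrite /iy inord_val.
  have im : (i <= m)%N by rewrite -ltnS ltn_ord.
  by rewrite /mk; case: s; rewrite mkpoint_iy // coef_jet.
have -> : rshift (m.+1 + m.+1) i = iz i by rewrite /iz inord_val.
have im : (i <= m)%N by rewrite -ltnS ltn_ord.
by rewrite /mk; case: s; rewrite mkpoint_iz // coef_jet.
Qed.

Lemma eq_mk s x y z x' y' z' :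
  x = x' -> y = y' -> z = z' -> mk s x y z =1 mk s x' y' z'.
Proof. by move=> -> -> ->. Qed.

Lemma eq_jets s v w : jx v = jx w -> jY s v = jY s w -> jZ s v = jZ s w -> v =1 w.
Proof.
by move=> ex eY eZ t; rewrite (mk_jets s v t) (mk_jets s w t); apply: eq_mk.
Qed.

Lemma eq_jet (f g : nat -> k) :
  (forall i, (i <= m)%N -> (jet f)`_i = (jet g)`_i) -> jet f = jet g.
Proof.
move=> fg; apply: jet_coefK; first exact: size_jet.
by move=> i im; rewrite -fg // coef_jet.
Qed.

(** Once [x] has order at least i, the coefficient of t^(2i) in the equation is x_i^2 alone: the
    other terms have order at least 3a or i + 2a, both above 2i. *)
Lemma on_jets_low_x a v i : on_jets v -> low a (jY false v) -> low a (jZ false v) ->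
  (2 * i < 3 * a)%N -> (2 * i <= m)%N -> (jx v)`_i = 0.
Proof.
move=> gv ya za; elim/ltn_ind: i => i IHi ia im.
have xi : low i (jx v) by move=> j ji; apply: IHi; lia.
have := gv _ im; rewrite /gpoly !coefD.
rewrite {1}mul2n -addnn expr2 (coefM_low xi xi).
rewrite expr2 (lowM (lowM ya ya) za); last by lia.
rewrite expr2 (lowM ya (lowM za za)); last by lia.
rewrite (lowM (lowM xi ya) za); last by lia.
by rewrite !addr0 => /eqP; rewrite mulf_eq0 orbb => /eqP.
Qed.

Definition locus s r v : Prop :=
  [/\ low r.+1 (jx v), low r (jY s v), low r (jZ s v), (jZ s v)`_r != 0
    & on_jets v].

Hypothesis k2 : (2 \in [pchar k])%N.

(** Common scheme for the loci of order 1 and 2. A parameter gives [x], [z] and the free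
    coefficients [b] of [y]. [solve] settles the equations above t^(3r), the hypotheses those up to
    t^(3r). *)
Lemma solved_irreducible s r (A : point -> Prop) (h : {mpoly k[NV m]})
    (x z : point -> {poly k}) (b : point -> nat -> k) :
    regular_poly h x -> regular_poly h z ->
    (forall i, regular_off h (fun w => b w i)) ->
    regular_off h (fun w => ((z w)`_r)^-1) ->
    (forall w, size (x w) <= m.+1)%N -> (forall w, size (z w) <= m.+1)%N ->
    (r <= m)%N ->
    (forall w, h.@[w] != 0 -> [/\ low r.+1 (x w), low (3 * r) (x w ^+ 2),
      low r (z w), (z w)`_r != 0 & forall i, (i < r)%N -> b w i = 0]) ->
    (forall w, h.@[w] != 0 -> (3 * r <= m)%N ->
      (x w ^+ 2)`_(3 * r) + b w r * (z w)`_r * (b w r + (z w)`_r) = 0) ->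
    (forall v, A v <-> locus s r v /\ exists2 w, h.@[w] != 0 &
      [/\ jx v = x w, jZ s v = z w & forall j, (j <= m)%N ->
        ~~ determined m r j -> (jY s v)`_j = b w j]) ->
  irreducible_locus A.
Proof.
move=> xR zR bR zrR xm zm rm low_w lead_w AE.
pose y w := solve m r (x w) (z w) (b w) m.+1.
have ym w : (size (y w) <= m.+1)%N by apply: size_solve.
pose phi w := mk s (x w) (y w) (z w).
apply: (@parametrised_irreducible _ _ _ _ h phi) => [t|w hw|v /AE].
- have yR := regular_solve m m.+1 xR zR bR zrR.
  case: s @phi AE => phi _; rewrite /phi /mk /mkpoint;
    case: (split t) => [t1|i] //; case: (split t1) => i //.
- have [xr x3 zr zr0 br] := low_w w hw.
  have nd i : (i <= r)%N -> (y w)`_i = b w i.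
    move=> ir; rewrite coef_solve ?ltnS ?(leq_trans ir) //.
    by rewrite /determined ltnNge ir.
  have yr : low r (y w) by move=> i ir; rewrite nd ?br ?(ltnW ir).
  apply/AE; rewrite /phi; split; last first.
    exists w => //; rewrite jx_mk // jZ_mk // jY_mk //; split=> // j jm /negPf dj.
    by rewrite coef_solve // dj.
  split; rewrite ?jx_mk ?jZ_mk ?jY_mk // => l lm.
  rewrite (on_jetsE s) jx_mk // jY_mk // jZ_mk //.
  case: (ltngtP l (3 * r)) => [lr|lr|lE].
  + by rewrite (gpoly_low xr) // x3.
  + by rewrite /y solveP // lr lm.
  + by rewrite lE gpoly_coef3 // nd // lead_w // -lE.
- case=> -[xr yr zr zr0 gv] [w hw [xE zE yE]]; exists w => // t.
  rewrite (mk_jets s v t); apply: eq_mk => //.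
  rewrite /y -xE -zE; apply: solve_unique => //; first exact: size_jet.
  by move=> l /andP[_ lm]; rewrite -on_jetsE gv.
Qed.

End JetPoints.

(** * Parametrised loci *)

Lemma regular_poly_of (k : closedFieldType) n (h : {mpoly k[n]}) d
    (f : ('I_n -> k) -> nat -> k) :
  (forall i, regular_off h (fun w => f w i)) ->
  regular_poly h (fun w => \poly_(i < d) f w i).
Proof.
move=> fR i; case: (ltnP i d) => id.
  by apply: regular_ext (fR i) => w _; rewrite coef_poly id.
by apply: regular_ext (regular_const h 0) => w _; rewrite coef_poly ltnNge id.
Qed.

Section CharTwo.
Variables (k : closedFieldType) (k2 : (2 \in [pchar k])%N).

Lemma sqrt_exists (c : k) : exists a, a ^+ 2 = c.
Proof.
have /closed_rootP[a /rootP] : size ('X^2 - c%:P) != 1%N by rewrite size_XnsubC.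
rewrite hornerD hornerN hornerXn hornerC => /eqP; rewrite subr_eq0 => /eqP.
by exists a.
Qed.

Lemma sqr_inj2 : injective (fun a : k => a ^+ 2).
Proof.
move=> a b /eqP; rewrite eqf_sqr => /orP[/eqP //|/eqP ->].
by rewrite oppr_pchar2.
Qed.

Variable m : nat.
Hypothesis m5 : (5 <= m)%N.
Local Notation point := ('I_(NV m) -> k).
Local Notation ix := (@ix m).
Local Notation iY := (@iY m).
Local Notation iZ := (@iZ m).

(** The coordinates of the point serve as parameters. As x^2 has order at least 4, the equation at
    t^3 reads eps (eps + 1) z_1^3 = 0, which holds in characteristic 2. *)
Lemma locus1_irreducible s (eps : bool) :
  irreducible_locus (fun v : point =>
    locus s 1 v /\ (jY s v)`_1 = eps%:R * (jZ s v)`_1).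
Proof.
have eps2 : eps%:R * (eps%:R + 1) = 0 :> k.
  by case: eps; rewrite ?mul0r // mul1r -(pcharf0 k2).
pose h : {mpoly k[NV m]} := 'X_(iZ s 1).
have hE w : h.@[w] = w (iZ s 1) by rewrite mevalXU.
pose x (w : point) : {poly k} := \poly_(i < m.+1) if (i < 2)%N then 0 else w (ix i).
pose z (w : point) : {poly k} :=
  \poly_(i < m.+1) if (i < 1)%N then 0 else w (iZ s i).
pose b (w : point) i : k := if (i < 1)%N then 0 else
  if i == 1%N then eps%:R * w (iZ s 1) else w (iY s i).
have z1 w : (z w)`_1 = w (iZ s 1) by rewrite coef_poly ifT //; lia.
have xlow w : low 2 (x w).
  by move=> i i2; rewrite coef_poly i2; case: ifP.
apply: (@solved_irreducible _ m k2 s 1 _ h x z b) => //.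
- apply: regular_poly_of => i.
  by case: (i < 2)%N; [exact: regular_const|exact: regular_var].
- apply: regular_poly_of => i.
  by case: (i < 1)%N; [exact: regular_const|exact: regular_var].
- move=> i; rewrite /b; case: (i < 1)%N; first exact: regular_const.
  case: (i == 1%N); last exact: regular_var.
  by apply: regularM; [exact: regular_const|exact: regular_var].
- by apply: regular_ext (regular_invh h) => w _; rewrite z1 hE.
- by move=> w; apply: size_poly.
- by move=> w; apply: size_poly.
- by lia.
- move=> w; rewrite hE => hw; split=> //.
  + by rewrite expr2; apply: lowW (lowM (xlow w) (xlow w)).
  + by move=> i i1; rewrite coef_poly i1; case: ifP.
  + by rewrite z1.
  + by move=> i i1; rewrite /b i1.
- move=> w _ _; rewrite expr2 (lowM (xlow w) (xlow w)) // add0r z1 /b /=.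
  by rewrite -[RHS](mul0r (w (iZ s 1) ^+ 3)) -eps2; ring.
move=> v; split=> [[[xr yr zr zr0 gv] y1]|[lv [w hw [xE zE yE]]]].
  split=> //; exists v; first by rewrite hE; move: zr0; rewrite coef_jet //; lia.
  split.
  - apply/polyP => i; rewrite !coef_poly; case: ifP => // im; case: ifP => // i2.
    by rewrite -(coef_jet (fun i => v (ix i)) (im : (i <= m)%N)) xr.
  - apply/polyP => i; rewrite !coef_poly; case: ifP => // im; case: ifP => // i1.
    by rewrite -(coef_jet (fun i => v (iZ s i)) (im : (i <= m)%N)) zr.
  - move=> j jm _; rewrite /b; case: ifP => [j1|_]; first by rewrite yr.
    case: eqP => [->|_]; last by rewrite coef_jet.
    by rewrite y1 coef_jet //; lia.
split=> //; rewrite zE z1 yE /b //; lia.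
Qed.

(** The parameters in the places of y_2 and z_2 are square roots of these coordinates. The equation
    at t^6 then says that x_3 and [lead] have the same square, hence are equal. *)
Lemma locus2_irreducible s : irreducible_locus (fun v : point => locus s 2 v).
Proof.
pose h : {mpoly k[NV m]} := 'X_(iZ s 2).
have hE w : h.@[w] = w (iZ s 2) by rewrite mevalXU.
pose lead (w : point) := w (iY s 2) * w (iZ s 2) * (w (iY s 2) + w (iZ s 2)).
(* For m = 5 there is no equation at t^6, and x_3 stays free. *)
pose x (w : point) : {poly k} := \poly_(i < m.+1)
  if (i < 3)%N then 0 else if (i == 3%N) && (6 <= m)%N then lead w else w (ix i).
pose z (w : point) : {poly k} := \poly_(i < m.+1)
  if (i < 2)%N then 0 else if i == 2%N then w (iZ s 2) ^+ 2 else w (iZ s i).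
pose b (w : point) i : k := if (i < 2)%N then 0 else
  if i == 2%N then w (iY s 2) ^+ 2 else w (iY s i).
have z2 w : (z w)`_2 = w (iZ s 2) ^+ 2 by rewrite coef_poly ifT //; lia.
have xlow w : low 3 (x w).
  by move=> i i3; rewrite coef_poly i3; case: ifP.
have varR t : regular_off h (fun w => w t) by apply: regular_var.
have leadR : regular_off h lead.
  by apply: regularM; [apply: regularM|apply: regularD].
have lead2 w : lead w ^+ 2 =
    w (iY s 2) ^+ 2 * w (iZ s 2) ^+ 2 * (w (iY s 2) ^+ 2 + w (iZ s 2) ^+ 2).
  have two0 : 2%:R = 0 :> k := pcharf0 k2.
  by rewrite /lead; ring: two0.
apply: (@solved_irreducible _ m k2 s 2 _ h x z b) => //.
- apply: regular_poly_of => i; case: (i < 3)%N; first exact: regular_const.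
  by case: (_ && _).
- apply: regular_poly_of => i; case: (i < 2)%N; first exact: regular_const.
  by case: (i == 2%N) => //; apply: regularX.
- move=> i; rewrite /b; case: (i < 2)%N; first exact: regular_const.
  by case: (i == 2%N) => //; apply: regularX.
- apply: regular_ext (regularX 2 (regular_invh h)) => w _.
  by rewrite z2 hE exprVn.
- by move=> w; apply: size_poly.
- by move=> w; apply: size_poly.
- by lia.
- move=> w; rewrite hE => hw; split=> //.
  + by rewrite expr2; apply: (lowM (xlow w) (xlow w)).
  + by move=> i i2; rewrite coef_poly i2; case: ifP.
  + by rewrite z2 expf_neq0.
  + by move=> i i2; rewrite /b i2.
- move=> w _ m6; rewrite expr2 (coefM_low (xlow w) (xlow w)) z2 /b /=.
  rewrite coef_poly ifT /=; last by lia.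
  rewrite ifT; last by lia.
  by rewrite -expr2 lead2 -mulr2n -mulr_natr (pcharf0 k2) mulr0.
move=> v; split=> [lv|[]//]; split=> //; case: lv => [xr yr zr zr0 gv].
have [zeta zetaE] := sqrt_exists (v (iZ s 2)).
have [eta etaE] := sqrt_exists (v (iY s 2)).
have jE (f : nat -> k) i : (i <= 5)%N -> (jet m f)`_i = f i.
  by move=> i5; rewrite coef_jet // (leq_trans i5).
pose w : point := mk s (jx v)
  (jet m (fun i => if i == 2%N then eta else v (iY s i)))
  (jet m (fun i => if i == 2%N then zeta else v (iZ s i))).
have wZi i : (i <= m)%N -> w (iZ s i) = if i == 2%N then zeta else v (iZ s i).
  by move=> im; rewrite /w mk_iZ // coef_jet.
have wYi i : (i <= m)%N -> w (iY s i) = if i == 2%N then eta else v (iY s i).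
  by move=> im; rewrite /w mk_iY // coef_jet.
have wXi i : (i <= m)%N -> w (ix i) = v (ix i).
  by move=> im; rewrite /w mk_ix // coef_jet.
have m2 : (2 <= m)%N by lia.
have wZ : w (iZ s 2) = zeta by rewrite wZi.
have wY : w (iY s 2) = eta by rewrite wYi.
exists w.
  rewrite hE wZ; apply: contraNneq zr0 => zeta0.
  by rewrite jE // -zetaE zeta0 expr0n.
split.
- apply/polyP => i; rewrite !coef_poly; case: ifP => // im; case: ifP => [i3|_].
    by rewrite -(coef_jet (fun i => v (ix i)) (im : (i <= m)%N)) xr.
  rewrite wXi //; case: ifP => // /andP[/eqP -> m6]; apply: sqr_inj2.
  rewrite /= lead2 wY wZ zetaE etaE.
  have := gpoly_coef3 xr yr zr; rewrite -on_jetsE gv // => /esym /eqP.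
  rewrite expr2 (coefM_low xr xr) -expr2 !jE // addr_eq0 oppr_pchar2 //.
  by move/eqP.
- apply/polyP => i; rewrite !coef_poly; case: ifP => // im; case: ifP => [i2|_].
    by rewrite -(coef_jet (fun i => v (iZ s i)) (im : (i <= m)%N)) zr.
  case: eqP => [->|/eqP/negPf i2]; first by rewrite wZ zetaE.
  by rewrite wZi // i2.
- move=> j jm _; rewrite /b; case: ifP => [j2|_]; first by rewrite yr.
  rewrite coef_jet //; case: eqP => [->|/eqP/negPf j2]; first by rewrite wY etaE.
  by rewrite wYi // j2.
Qed.

End CharTwo.

(** * Density in the degenerate component *)

Section Density.
Variables (k : closedFieldType) (k2 : (2 \in [pchar k])%N).
Variables (m : nat) (m5 : (5 <= m)%N).
Local Notation point := ('I_(NV m) -> k).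
Local Notation ix := (@ix m).
Local Notation iY := (@iY m).
Local Notation iZ := (@iZ m).
Implicit Types u v : point.

Definition base v : Prop :=
  [/\ low 3 (jx v), low 2 (jY false v), low 2 (jZ false v) & on_jets v].

(** On [base] the coefficients below t^6 vanish by order alone, which leaves 7 coordinates and m - 5
    coefficients: m + 2 equations in 3m + 3 variables. Each fixed coordinate adds one. *)
Lemma base_dimension (fixed : seq 'I_(NV m)) (h : {mpoly k[NV m]}) u :
    base u -> h.@[u] != 0 ->
    (forall u', base u' -> h.@[u'] != 0 -> {in fixed, u' =1 u} -> u' =1 u) ->
  (2 * m < size fixed)%N.
Proof.
clear k2; move=> [x3 y2 z2 gu] hu iso.
pose vars := [:: ix 0; ix 1; ix 2; iY false 0; iY false 1; iZ false 0; iZ false 1].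
pose fs := [seq 'X_t | t <- vars] ++ [seq gj k m j | j <- iota 6 (m - 5)]
  ++ [seq 'X_t - (u t)%:MP | t <- fixed].
have jE (f : nat -> k) i : (i <= 5)%N -> (jet m f)`_i = f i.
  by move=> i5; rewrite coef_jet // (leq_trans i5).
have xE i : (i < 3)%N -> u (ix i) = 0 by move=> i3; rewrite -(x3 i) // jE //; lia.
have yE i : (i < 2)%N -> u (iY false i) = 0.
  by move=> i2; rewrite -(y2 i) // jE //; lia.
have zE i : (i < 2)%N -> u (iZ false i) = 0.
  by move=> i2; rewrite -(z2 i) // jE //; lia.
suff : (NV m <= size fs)%N by rewrite !size_cat !size_map size_iota /NV /=; lia.
apply: (@isolated_zero_dimension _ _ fs h u) => //.
  move=> g; rewrite !mem_cat => /or3P[]/mapP[t tin ->].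
  - rewrite mevalXU; move: tin; rewrite !inE.
    by do ![case/orP]; move/eqP=> ->; rewrite ?xE ?yE ?zE.
  - by rewrite meval_gj gu //; move: tin; rewrite mem_iota; lia.
  - by rewrite mevalB mevalXU mevalC subrr.
move=> u' fsu' hu'.
have var0 t : t \in vars -> u' t = 0.
  by move=> tv; rewrite -[LHS]mevalXU; apply: fsu';
    rewrite mem_cat (map_f (fun t => 'X_t)).
apply: iso => //; last first.
  move=> t tf; apply/eqP; rewrite -subr_eq0.
  have : ('X_t - (u t)%:MP).@[u'] = 0.
    apply: fsu'; rewrite !mem_cat.
    by rewrite (map_f (fun t => 'X_t - (u t)%:MP)) ?orbT.
  by rewrite mevalB mevalXU mevalC => ->.
have x3' : low 3 (jx u').
  by case=> [|[|[|//]]] _; rewrite jE // var0 // !inE eqxx ?orbT.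
have y2' : low 2 (jY false u').
  by case=> [|[|//]] _; rewrite jE // var0 // !inE eqxx ?orbT.
have z2' : low 2 (jZ false u').
  by case=> [|[|//]] _; rewrite jE // var0 // !inE eqxx ?orbT.
split=> // j jm; have [j6|j6] := ltnP j 6.
  by rewrite (gpoly_low x3') // expr2 (lowM x3' x3').
rewrite -meval_gj; apply: fsu'; rewrite !mem_cat.
by rewrite (map_f (fun j => gj k m j)) ?orbT // mem_iota; lia.
Qed.

(** * Principal open subsets of the degenerate component *)

Section Isolation.
Variable p : {mpoly k[NV m]}.
Let N v := base v /\ p.@[v] != 0.
Let S a := forall v, N v -> low a (jY false v) /\ low a (jZ false v).

Let lowS s a v : S a -> N v -> low a (jY s v) /\ low a (jZ s v).
Proof. by move=> Sa /Sa[]; case: s. Qed.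


(** Up to t^m only x^2 contributes, so x_i = 0 for 2i <= m and all other coordinates that may be
    nonzero can be fixed. With a >= 3 and m < 3a these are at most 2m, too few for
    [base_dimension]. *)
Lemma very_degenerate_empty a v :
  (3 <= a <= m)%N -> (m < 3 * a)%N -> S a -> ~ N v.
Proof.
move=> /andP[a3 am] ma Sa [bv pv].
pose fixed := [seq ix i | i <- iota (m %/ 2).+1 (m - m %/ 2)]
  ++ [seq iY false i | i <- iota a (m.+1 - a)]
  ++ [seq iZ false i | i <- iota a (m.+1 - a)].
suff : (2 * m < size fixed)%N by rewrite !size_cat !size_map !size_iota; lia.
apply: (base_dimension bv pv) => u bu pu uv.
have fixE (ii : nat -> 'I_(NV m)) i : (i <= m)%N -> ii i \in fixed ->
    (jet m (fun i => u (ii i)))`_i = (jet m (fun i => v (ii i)))`_i.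
  by move=> im /uv; rewrite !coef_jet.
have [[yu zu] [yv zv]] := (Sa u (conj bu pu), Sa v (conj bv pv)).
apply: (@eq_jets _ _ false); apply: eq_jet => i im.
- have [im2|im2] := leqP (2 * i) m.
    case: bu bv => [_ _ _ gu] [_ _ _ gv].
    by rewrite [LHS](on_jets_low_x gu yu zu) ?[RHS](on_jets_low_x gv yv zv) //; lia.
  by apply: fixE => //; rewrite !mem_cat map_f // mem_iota; lia.
- have [ia|ia] := ltnP i a; first by rewrite [LHS]yu ?[RHS]yv.
  by apply: (fixE (iY false)) => //; rewrite !mem_cat map_f ?orbT // mem_iota; lia.
- have [ia|ia] := ltnP i a; first by rewrite [LHS]zu ?[RHS]zv.
  by apply: (fixE (iZ false)) => //; rewrite !mem_cat map_f ?orbT // mem_iota; lia.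
Qed.

(** If z_a were nonzero, the coordinates in [fixed] would isolate [v], since the y_j with a < j <= m
    - 2a are solved for. Their number is 2m + 2 - a/2 for even a and 2m + 1 - (a-1)/2 for odd a, at
    most 2m since a >= 3. *)
Lemma degenerate_step s a v : (3 <= a)%N -> (3 * a <= m)%N -> S a -> N v ->
  (jZ s v)`_a = 0.
Proof.
move=> a3 am Sa [bv pv]; apply/eqP/negPn/negP => za0.
pose fixed := [seq ix i | i <- iota ((3 * a) %/ 2).+1 (m - (3 * a) %/ 2)]
  ++ [seq iZ s i | i <- iota a (m.+1 - a)]
  ++ (if odd a then [::] else [:: iY s a])
  ++ [seq iY s i | i <- iota (m - 2 * a).+1 (2 * a)].
suff : (2 * m < size fixed)%N.
  rewrite !size_cat !size_map !size_iota.
  by have := odd_double_half a; rewrite -muln2; case: odd => /=; lia.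
have am' : (a <= m)%N by lia.
have vaE : ((jY s v)`_a = v (iY s a)) * ((jZ s v)`_a = v (iZ s a)).
  by rewrite !coef_jet.
(* For odd a the equation at t^(3a) leaves two values for y_a, 0 and z_a. The last factor excludes
   the one not taken at [v]. *)
pose h := p * 'X_(iZ s a) *
  (if odd a then 'X_(iY s a) + (v (iY s a) + v (iZ s a))%:MP else 1).
have hv : h.@[v] != 0.
  have zv0 : v (iZ s a) != 0 by rewrite -vaE.
  rewrite !mevalM mevalXU !mulf_neq0 //.
  case: odd; last by rewrite meval1 oner_neq0.
  by rewrite mevalD mevalXU mevalC addrA addrr_pchar2 // add0r.
apply: (base_dimension bv hv) => u bu hu uv.
move: hu; rewrite !mevalM !mulf_eq0 !negb_or mevalXU => /andP[/andP[pu uz0] hodd].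
have uaE : ((jY s u)`_a = u (iY s a)) * ((jZ s u)`_a = u (iZ s a)).
  by rewrite !coef_jet.
have fixE (ii : nat -> 'I_(NV m)) i : (i <= m)%N -> ii i \in fixed ->
    (jet m (fun i => u (ii i)))`_i = (jet m (fun i => v (ii i)))`_i.
  by move=> im /uv; rewrite !coef_jet.
have [[yu zu] [yv zv]] := (lowS s Sa (conj bu pu), lowS s Sa (conj bv pv)).
have xlow w : N w -> low ((3 * a).+1 %/ 2) (jx w).
  move=> Nw i ia; have [yw zw] := Sa w Nw; case: Nw => -[_ _ _ gw] _.
  by apply: (on_jets_low_x gw yw zw); lia.
have xlow1 w : N w -> low a.+1 (jx w) by move/xlow; apply: lowW; lia.
have g3 w : N w -> (jx w ^+ 2)`_(3 * a)
    + (jY s w)`_a * (jZ s w)`_a * ((jY s w)`_a + (jZ s w)`_a) = 0.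
  move=> Nw; have [yw zw] := lowS s Sa Nw.
  rewrite -gpoly_coef3 // -?on_jetsE; last exact: xlow1.
  by case: Nw => -[_ _ _ gw] _; apply: gw.
have Nu : N u by []; have Nv : N v by [].
have zE : jZ s u = jZ s v.
  apply: eq_jet => i im; have [ia|ia] := ltnP i a.
    by rewrite [LHS]zu ?[RHS]zv.
  by apply: (fixE (iZ s)) => //; rewrite !mem_cat map_f ?orbT // mem_iota; lia.
have yaE : (jY s u)`_a = (jY s v)`_a.
  have [aodd|aeven] := boolP (odd a); last first.
    by apply: (fixE (iY s)) => //; rewrite !mem_cat (negPf aeven) !inE eqxx !orbT.
  have root w : N w -> (jZ s w)`_a != 0 ->
      (jY s w)`_a = 0 \/ (jY s w)`_a = (jZ s w)`_a.
    move=> Nw zw0; have := g3 w Nw.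
    rewrite expr2 (lowM (xlow w Nw) (xlow w Nw)); last first.
      by have := odd_double_half a; rewrite aodd -muln2; lia.
    move/eqP; rewrite add0r !mulf_eq0 (negPf zw0) orbF addr_eq0 oppr_pchar2 //.
    by case/orP => /eqP; [left|right].
  move: hodd; rewrite aodd mevalD mevalXU mevalC -!vaE -uaE => hodd.
  have zu0 : (jZ s u)`_a != 0 by rewrite uaE.
  move: hodd; case: (root u Nu zu0) => ->; case: (root v Nv za0) => ->;
    rewrite ?zE //.
  - by rewrite addrr_pchar2 // addr0 eqxx.
  - by rewrite add0r addrr_pchar2 // eqxx.
have xE : jx u = jx v.
  apply: eq_jet => i im; have [ia|ia] := leqP (2 * i) (3 * a); last first.
    by apply: fixE => //; rewrite !mem_cat map_f // mem_iota; lia.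
  have [ia'|ia'] := ltnP i ((3 * a).+1 %/ 2).
    by rewrite [LHS](xlow u Nu) ?[RHS](xlow v Nv).
  (* Here a is even, and the equation at t^(3a) gives x_i^2 in terms of y_a and z_a; squaring is
     injective. *)
  have i3a : (3 * a = i + i)%N by lia.
  have xi w : N w -> low i (jx w) by move/xlow; apply: lowW; lia.
  apply: (sqr_inj2 k2); rewrite /= !expr2.
  rewrite -[LHS](coefM_low (xi u Nu) (xi u Nu)).
  rewrite -[RHS](coefM_low (xi v Nv) (xi v Nv)) -i3a -!expr2.
  by have := etrans (g3 u Nu) (esym (g3 v Nv)); rewrite yaE zE => /addIr.
apply: (@eq_jets _ _ s) => //.
have solved w : N w -> jx w = jx v -> jZ s w = jZ s v ->
    (forall j, (j <= m)%N -> ~~ determined m a j -> (jY s w)`_j = (jY s v)`_j) ->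
    jY s w = solve m a (jx v) (jZ s v) (fun j => (jY s v)`_j) m.+1.
  move=> Nw xw zw yw; apply: solve_unique => //; [exact: xlow1|exact: size_jet|].
  move=> l /andP[_ lm]; rewrite -xw -zw -on_jetsE.
  by case: Nw => -[_ _ _ gw] _; apply: gw.
rewrite (solved u) // => [|j jm]; first by rewrite -(solved v).
rewrite /determined negb_and -!leqNgt -ltnNge => jd.
case: (ltngtP j a) => [ja|ja|->]; last exact: yaE.
  by rewrite [LHS]yu ?[RHS]yv.
apply: (fixE (iY s)) => //.
by rewrite !mem_cat (map_f (iY s)) ?orbT // mem_iota; lia.
Qed.

(** [degenerate_step], applied to both y and z, raises their common order until 3a exceeds m, where
    [very_degenerate_empty] concludes. *)
Lemma N_empty : S 3 -> forall v, ~ N v.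
Proof.
move=> S3 v Nv.
have Sall a : (3 <= a)%N -> (3 * a <= m + 3)%N -> S a.
  elim: a => // a IHa; rewrite ltnS => a3 am.
  have [->//|a3'] : a = 2%N \/ (3 <= a)%N by lia.
  have Sa : S a by apply: IHa; lia.
  move=> u Nu; have [yu zu] := Sa u Nu; split=> i; rewrite ltnS leq_eqVlt.
    case/orP => [/eqP ->|/yu //].
    by apply: (@degenerate_step true) Nu => //; lia.
  case/orP => [/eqP ->|/zu //].
  by apply: (@degenerate_step false) Nu => //; lia.
have [ma|ma] := ltnP m 9.
  by apply: (@very_degenerate_empty 3) Nv => //; lia.
by apply: (@very_degenerate_empty (m %/ 3).+1) Nv; [lia|lia|apply: Sall; lia].
Qed.

End Isolation.

(** If [p] vanished on the locus z_2 <> 0, then z_2 = 0 on [base] off the zeros of [p]. So is y_2: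
    the locus y_2 <> 0 is irreducible and has points with z_2 <> 0, so if [p] were nonzero somewhere
    on it, [p] and z_2 would be nonzero together. This contradicts [N_empty]. *)
Lemma locus2_dense p v : base v -> p.@[v] != 0 ->
  nonvanishing_on (fun v => locus false 2 v) p.
Proof.
move=> bv pv; apply: boolp.contrapT => nop.
have m2 : (2 <= m)%N by lia.
apply: (@N_empty p _ v (conj bv pv)) => u [[x3 y2 z2 gu] pu].
have z0 w : base w -> p.@[w] != 0 -> (jZ false w)`_2 = 0.
  move=> [xw yw zw gw] pw; apply/eqP/negPn/negP => zw0.
  by apply: nop; exists w.
have zu0 := z0 u (And4 x3 y2 z2 gu) pu.
have yu0 : (jY false u)`_2 = 0.
  apply/eqP/negPn/negP => yu0.
  have pA : nonvanishing_on (fun v => locus true 2 v) p by exists u.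
  have zA : nonvanishing_on (fun v : point => locus true 2 v) 'X_(iZ false 2).
    (* The jet (0, t^2, t^2) satisfies the equation because 2 t^6 = 0. *)
    pose t2 : {poly k} := 'X^2.
    have s2 : (size t2 <= m.+1)%N by rewrite size_polyXn; lia.
    have l2 : low 2 t2 by case=> [|[|//]] _; rewrite coefXn.
    exists (mk true 0 t2 t2); last first.
      rewrite mevalXU (_ : mk _ _ _ _ _ = t2`_2); last exact: mkpoint_iz.
      by rewrite coefXn eqxx oner_neq0.
    split; rewrite ?jx_mk ?jY_mk ?jZ_mk ?size_poly0 //.
    - by move=> i _; rewrite coef0.
    - by rewrite coefXn eqxx oner_neq0.
    move=> j _; rewrite (on_jetsE true) jx_mk ?size_poly0 // jY_mk // jZ_mk //.
    have two0 : 2%:R = 0 :> {poly k} by rewrite -polyC_natr (pcharf0 k2) polyC0.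
    rewrite (_ : gpoly _ _ _ = 2%:R * t2 ^+ 3); last by rewrite /gpoly; ring.
    by rewrite two0 mul0r coef0.
  have [w [xw zw yw _ gw]] := locus2_irreducible k2 m5 pA zA.
  rewrite mevalM mevalXU mulf_eq0 negb_or => /andP[pw].
  by rewrite -(coef_jet (fun i => w (iZ false i)) m2) z0 ?eqxx.
split=> i; rewrite ltnS leq_eqVlt => /orP[/eqP -> //|].
- exact: y2.
- exact: z2.
Qed.

End Density.

(** * The four components *)

Lemma coefM_lowS (R : comNzRingType) (r s : nat) (p q : {poly R}) :
  low r p -> low s q -> (p * q)`_(r + s).+1 = p`_r * q`_s.+1 + p`_r.+1 * q`_s.
Proof.
move=> pr qs.
have r0 : (r < (r + s).+2)%N by lia.
have r1 : (r.+1 < (r + s).+2)%N by lia.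
rewrite coefM (bigD1 (Ordinal r0)) //= (bigD1 (Ordinal r1)) /=; last first.
  by rewrite -val_eqE /=; lia.
rewrite big1 => [|j]; first by rewrite addr0 subSS addKn -addnS addKn.
rewrite -!val_eqE /= => /andP[jr jr1].
have [jr'|rj] := ltnP j r; first by rewrite pr ?mul0r.
by rewrite [q`__]qs ?mulr0 //; have := ltn_ord j; lia.
Qed.

Section Components.
Variables (k : closedFieldType) (k2 : (2 \in [pchar k])%N).
Variables (m : nat) (m5 : (5 <= m)%N).
Local Notation point := ('I_(NV m) -> k).
Local Notation ix := (@ix m).
Local Notation iY := (@iY m).
Local Notation iZ := (@iZ m).
Implicit Types u v : point.

(** The flags (false, false), (true, false) and (true, true) give the dense loci of Z_1, Z_2 and
    Z_3. *)
Definition branch s (eps : bool) v : Prop :=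
  locus s 1 v /\ (jY s v)`_1 = eps%:R * (jZ s v)`_1.

Let jE (f : nat -> k) i : (i <= 5)%N -> (jet m f)`_i = f i.
Proof. by move=> i5; rewrite coef_jet // (leq_trans i5). Qed.

(* The coefficient of [t ^ 5], divided by its factor [z_1]. *)
Lemma branch_relation s (eps : bool) v : branch s eps v ->
  let w i := v (iY s i) + eps%:R * v (iZ s i) in
  v (iZ s 1) * (w 3 + eps%:R * v (ix 3)) + w 2 ^+ 2 + v (ix 2) * w 2 = 0.
Proof.
move=> [[xl yl zl z0 gv] y1] w.
have two0 : 2%:R = 0 :> k := pcharf0 k2.
pose x := jx v; pose z := jZ s v; pose e : {poly k} := eps%:R%:P.
(* [W] has order at least 2 on the branch. Substituting it for [y] removes the term in z^3, since
   e^2 = e and 2 = 0. *)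
pose W := jY s v + e * z.
have We i : (i <= 5)%N -> W`_i = w i.
  by move=> i5; rewrite coefD coefCM !jE.
have Wl : low 2 W.
  case=> [|[|//]] _; rewrite coefD coefCM.
    by rewrite yl // zl // mulr0 addr0.
  by rewrite y1 addrr_pchar2.
have gE : gpoly x (jY s v) z = x * x + W * W * z + W * (z * z) + x * W * z
    + e * (x * (z * z)).
  have two0' : 2%:R = 0 :> {poly k} by rewrite -polyC_natr two0 polyC0.
  have ee : e * e = e by rewrite /e -polyCM -natrM mulnb andbb.
  have -> : jY s v = W - e * z by rewrite addrK.
  transitivity (x * x + W * W * z + W * (z * z) + x * W * z + e * (x * (z * z))
      - 2%:R * (e * W * z ^+ 2 + e * x * z ^+ 2) + (e * e - e) * z ^+ 3).
    by rewrite /gpoly; ring.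
  by rewrite two0' ee subrr !mul0r subr0 addr0.
have xl2 : low 2 x := xl.
have zz := lowM zl zl.
have z1 : z`_1 = v (iZ s 1) by rewrite jE.
have := gv 5%N m5; rewrite (on_jetsE s) gE !coefD coefCM.
rewrite (coefM_lowS xl2 xl2) (coefM_low (lowM Wl Wl) zl) (coefM_low Wl Wl).
rewrite (coefM_lowS Wl zz) (coefM_lowS zl zl) (coefM_low zl zl).
rewrite (coefM_low (lowM xl2 Wl) zl) (coefM_low xl2 Wl).
rewrite (coefM_lowS xl2 zz) (coefM_lowS zl zl) (coefM_low zl zl).
rewrite !We // z1 !jE // => g5.
apply: (mulfI (x := v (iZ s 1))); first by rewrite -z1.
rewrite mulr0 -g5; apply/eqP; rewrite -subr_eq0; apply/eqP.
(* The two sides differ by twice the cross terms. *)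
rewrite -(mul0r (- (v (ix 2) * v (ix 3) + w 2 * v (iZ s 1) * v (iZ s 2)
   + eps%:R * v (ix 2) * v (iZ s 1) * v (iZ s 2)))) -two0.
by ring.
Qed.

Definition relation_poly s (eps : bool) : {mpoly k[NV m]} :=
  let w i : {mpoly k[NV m]} := 'X_(iY s i) + eps%:R * 'X_(iZ s i) in
  'X_(iZ s 1) * (w 3 + eps%:R * 'X_(ix 3)) + w 2 ^+ 2 + 'X_(ix 2) * w 2.

Lemma meval_relation_poly s eps v : (relation_poly s eps).@[v] =
  let w i := v (iY s i) + eps%:R * v (iZ s i) in
  v (iZ s 1) * (w 3 + eps%:R * v (ix 3)) + w 2 ^+ 2 + v (ix 2) * w 2.
Proof.
by rewrite /relation_poly !(mevalD, mevalM, rmorphXn, mevalXU, rmorph_nat).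
Qed.

Lemma branchE s eps v : branch s eps v <->
  [/\ v (ix 0) = 0, v (ix 1) = 0, v (iY s 0) = 0, v (iZ s 0) = 0
    & v (iY s 1) = eps%:R * v (iZ s 1)] /\ (v (iZ s 1) != 0 /\ on_jets v).
Proof.
rewrite /branch !jE //; split=> [[[xl yl zl]]|[[x0 x1 y0 z0 y1] [z1 gv]]].
  rewrite jE // => z1 gv y1; do !split=> //.
  - by rewrite -(xl 0%N) ?jE.
  - by rewrite -(xl 1%N) ?jE.
  - by rewrite -(yl 0%N) ?jE.
  - by rewrite -(zl 0%N) ?jE.
split=> //; split; rewrite ?jE //.
- by case=> [|[|//]] _; rewrite jE.
- by case=> [|//] _; rewrite jE.
- by case=> [|//] _; rewrite jE.
Qed.

Lemma baseE v : base v <->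
  [/\ v (ix 0) = 0, v (ix 1) = 0 & v (ix 2) = 0] /\
  ([/\ v (iY false 0) = 0, v (iY false 1) = 0, v (iZ false 0) = 0
    & v (iZ false 1) = 0] /\ on_jets v).
Proof.
split=> [[xl yl zl gv]|[[x0 x1 x2] [[y0 y1 z0 z1] gv]]].
  do !split=> //.
  - by rewrite -(xl 0%N) ?jE.
  - by rewrite -(xl 1%N) ?jE.
  - by rewrite -(xl 2%N) ?jE.
  - by rewrite -(yl 0%N) ?jE.
  - by rewrite -(yl 1%N) ?jE.
  - by rewrite -(zl 0%N) ?jE.
  - by rewrite -(zl 1%N) ?jE.
split=> //.
- by case=> [|[|[|//]]] _; rewrite jE.
- by case=> [|[|//]] _; rewrite jE.
- by case=> [|[|//]] _; rewrite jE.
Qed.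

Lemma zeros_cat v (gs hs : seq {mpoly k[NV m]}) :
  {in gs ++ hs, forall g, g.@[v] = 0} <->
  all (fun g => g.@[v] == 0) gs /\ {in hs, forall g, g.@[v] = 0}.
Proof.
split=> [gsv|[/allP gsv hsv] g].
  split; last by move=> g gh; apply: gsv; rewrite mem_cat gh orbT.
  by apply/allP => g gg; apply/eqP/gsv; rewrite mem_cat gg.
by rewrite mem_cat => /orP[/gsv/eqP|/hsv].
Qed.

Lemma S0_mP v : @S0_m k m v <->
  [/\ v (ix 0) = 0, v (iY false 0) = 0 & v (iZ false 0) = 0] /\ on_jets v.
Proof.
rewrite /S0_m Vset_in_ideal zeros_cat gens_gP /= !mevalXU andbT.
split=> -[]; first by case/and3P => /eqP ? /eqP ? /eqP ?; split.
by move=> [x0 y0 z0] gv; split=> //; rewrite x0 y0 z0 !eqxx.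
Qed.

Lemma I0_mP v : Vset (@I0_m k m) v <-> base v.
Proof.
rewrite /I0_m Vset_in_ideal zeros_cat gens_gP baseE /= !mevalXU andbT.
split=> [[]|[[x0 x1 x2] [[y0 y1 z0 z1] gv]]].
  case/and5P => /eqP ? /eqP ? /eqP ? /eqP ? /and3P[/eqP ? /eqP ? /eqP ?].
  by do !split.
by split=> //; rewrite x0 x1 x2 y0 y1 z0 z1 !eqxx.
Qed.

Lemma J1_mP v : {in J1_m k m, forall g, g.@[v] = 0} <->
  [/\ v (ix 0) = 0, v (ix 1) = 0, v (iY false 0) = 0, v (iZ false 0) = 0
    & v (iY false 1) = false%:R * v (iZ false 1)] /\ on_jets v.
Proof.
rewrite zeros_cat gens_gP /= !mevalXU andbT mul0r; split=> -[].
  by case/and5P => /eqP ? /eqP ? /eqP ? /eqP ? /eqP ?; split.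
by move=> [x0 x1 y0 z0 y1] gv; split=> //; rewrite x0 x1 y0 y1 z0 !eqxx.
Qed.

Lemma J2_mP v : {in J2_m k m, forall g, g.@[v] = 0} <->
  [/\ v (ix 0) = 0, v (ix 1) = 0, v (iY true 0) = 0, v (iZ true 0) = 0
    & v (iY true 1) = false%:R * v (iZ true 1)] /\ on_jets v.
Proof.
rewrite zeros_cat gens_gP /= !mevalXU andbT mul0r; split=> -[].
  by case/and5P => /eqP ? /eqP ? /eqP ? /eqP ? /eqP ?; split.
by move=> [x0 x1 y0 z0 y1] gv; split=> //; rewrite x0 x1 y0 y1 z0 !eqxx.
Qed.

Lemma J3_mP v : {in J3_m k m, forall g, g.@[v] = 0} <->
  [/\ v (ix 0) = 0, v (ix 1) = 0, v (iY true 0) = 0, v (iZ true 0) = 0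
    & v (iY true 1) = true%:R * v (iZ true 1)] /\ on_jets v.
Proof.
rewrite zeros_cat gens_gP /= mevalD !mevalXU andbT mul1r; split=> -[].
  case/and5P => /eqP ? /eqP ? /eqP ? /eqP ?.
  by rewrite addrC addr_eq0 oppr_pchar2 // => /eqP ?; split.
move=> [x0 x1 y0 z0 y1] gv; split=> //; rewrite x0 x1 y0 z0 !eqxx /=.
by rewrite addrC addr_eq0 oppr_pchar2 // y1.
Qed.

(** * The three saturated components *)

Section Component.
Variables (gs : seq {mpoly k[NV m]}) (s eps : bool).
Hypothesis gsP : forall v, {in gs, forall g, g.@[v] = 0} <->
  [/\ v (ix 0) = 0, v (ix 1) = 0, v (iY s 0) = 0, v (iZ s 0) = 0
    & v (iY s 1) = eps%:R * v (iZ s 1)] /\ on_jets v.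

Local Notation Z := (Vset (in_sat gs 'X_(iZ s 1))).

Lemma branch_sub v : branch s eps v -> Z v.
Proof.
move=> /branchE[v0 [z1 gv]]; apply: Vset_sat; last by rewrite mevalXU.
by apply/gsP.
Qed.

Lemma component_closure p v : Z v -> p.@[v] != 0 ->
  nonvanishing_on (branch s eps) p.
Proof.
move=> Zv /eqP pv; apply: boolp.contrapT => nop; apply: pv.
apply: Vset_sat_closure Zv => u /gsP[u0 gu]; rewrite mevalXU => z1.
apply/eqP/negPn/negP => pu; apply: nop; exists u => //.
by apply/branchE.
Qed.

Lemma component_relations v : Z v ->
  [/\ v (ix 0) = 0, v (ix 1) = 0, v (iY s 0) = 0, v (iZ s 0) = 0
    & v (iY s 1) = eps%:R * v (iZ s 1)] /\ on_jets v.
Proof.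
move=> Zv; apply/gsP => g gg; apply: Zv; exists 0%N.
by rewrite expr0 mul1r; apply: mem_in_ideal.
Qed.

Definition branch_point : point := mk s 0 (eps%:R *: 'X) 'X.

Lemma branch_pointP : branch s eps branch_point.
Proof.
have sX : (size (eps%:R *: 'X : {poly k}) <= m.+1)%N.
  by apply: leq_trans (size_scale_leq _ _) _; rewrite size_polyX; lia.
have s0 : (size ('X : {poly k}) <= m.+1)%N by rewrite size_polyX; lia.
rewrite /branch_point; split; last first.
  by rewrite jY_mk // jZ_mk // coefZ.
split; rewrite ?jx_mk ?jY_mk ?jZ_mk ?size_poly0 //.
- by move=> i _; rewrite coef0.
- by case=> // _; rewrite coefZ coefX mulr0.
- by case=> // _; rewrite coefX.
- by rewrite coefX oner_neq0.
move=> j _; rewrite (on_jetsE s) jx_mk ?size_poly0 // jY_mk // jZ_mk //.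
rewrite (_ : gpoly _ _ _ = 0) ?coef0 // /gpoly.
case: eps; rewrite /= ?mulr0n ?mulr1n ?scale0r ?scale1r; last by ring.
have two0 : 2%:R = 0 :> {poly k} by rewrite -polyC_natr (pcharf0 k2) polyC0.
by transitivity (2%:R * 'X ^+ 3 : {poly k}); [ring|rewrite two0 mul0r].
Qed.

Lemma component_irreducible : zclosed Z /\ zirreducible Z.
Proof.
split; first by exists (in_sat gs 'X_(iZ s 1)).
apply: (@zirreducible_closure _ _ (branch s eps)).
- by exists branch_point; apply: branch_pointP.
- exact: branch_sub.
- by move=> p v; apply: component_closure.
- exact: locus1_irreducible.
Qed.

Definition base_point : point := mk s 0 'X^2 0.

Lemma base_pointP : base base_point.
Proof.
have s2 : (size ('X^2 : {poly k}) <= m.+1)%N by rewrite size_polyXn; lia.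
have s0 : (size (0%R : {poly k}) <= m.+1)%N by rewrite size_poly0.
have l0 r : low r (0 : {poly k}) by move=> i _; rewrite coef0.
have l2 : low 2 ('X^2 : {poly k}) by case=> [|[|//]] _; rewrite coefXn.
have yl : low 2 (jY s base_point) by rewrite jY_mk.
have zl : low 2 (jZ s base_point) by rewrite jZ_mk.
split; first by rewrite jx_mk.
- by move: yl zl; case: s.
- by move: yl zl; case: s.
move=> j _; rewrite (on_jetsE s) jx_mk // jY_mk // jZ_mk //.
by rewrite (_ : gpoly _ _ _ = 0) ?coef0 // /gpoly; ring.
Qed.

(** The relation of [branch_relation] passes to the closure of the branch, but at this point its
    term w_2^2 is 1 and the others vanish. *)
Lemma base_point_notin : ~ Z base_point.
Proof.
move=> Zv; have s2 : (size ('X^2 : {poly k}) <= m.+1)%N by rewrite size_polyXn; lia.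
have s0 : (size (0%R : {poly k}) <= m.+1)%N by rewrite size_poly0.
have xE i : (i <= 5)%N -> base_point (ix i) = 0.
  by move=> i5; rewrite /base_point mk_ix ?coef0 // (leq_trans i5).
have yE i : (i <= 5)%N -> base_point (iY s i) = (i == 2%N)%:R.
  by move=> i5; rewrite /base_point mk_iY ?coefXn // (leq_trans i5).
have zE i : (i <= 5)%N -> base_point (iZ s i) = 0.
  by move=> i5; rewrite /base_point mk_iZ ?coef0 // (leq_trans i5).
have [|v bv /eqP[]] := @component_closure (relation_poly s eps) _ Zv.
  rewrite meval_relation_poly /= !xE // !yE // !zE //.
  by rewrite !mulr0 !mul0r !add0r !addr0 expr1n oner_neq0.
by rewrite meval_relation_poly; apply: branch_relation.
Qed.

End Component.

Lemma branch_point_coef s eps :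
  branch_point s eps (iY s 1) = eps%:R /\ branch_point s eps (iZ s 1) = 1.
Proof.
have := branch_pointP s eps; set v := branch_point s eps => -[[_ _ _ _ _]].
have s0 : (size ('X : {poly k}) <= m.+1)%N by rewrite size_polyX; lia.
have -> : (jZ s v)`_1 = 1 by rewrite jZ_mk // coefX.
rewrite jE // mulr1 => ->; split=> //.
by rewrite -(jE (fun i => v (iZ s i)) (isT : 1 <= 5)%N) [jet m _]jZ_mk // coefX.
Qed.

(** The coefficient of t^2 gives x_1 = 0, and that of t^3 is then y_1 z_1 (y_1 + z_1). If y_1 = z_1
    = 0, the coefficient of t^4 gives x_2 = 0. *)
Lemma S0_m_cover v : @S0_m k m v ->
  base v \/ exists2 c, c \in [:: (false, false); (true, false); (true, true)]
                     & branch c.1 c.2 v.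
Proof.
move=> /S0_mP[[x0 y0 z0] gv].
have yl : low 1 (jY false v) by case=> // _; rewrite jE.
have zl : low 1 (jZ false v) by case=> // _; rewrite jE.
have x1 : v (ix 1) = 0.
  by rewrite -[RHS](on_jets_low_x gv yl zl (i := 1)) ?jE //; lia.
have xl : low 2 (jx v) by case=> [|[|//]] _; rewrite jE.
have := gpoly_coef3 xl yl zl; rewrite gv ?expr2 ?(lowM xl xl) //; last by lia.
rewrite add0r !jE // => /esym/eqP; rewrite !mulf_eq0.
have brE s (eps : bool) : v (iY s 1) = eps%:R * v (iZ s 1) -> v (iZ s 1) != 0 ->
    branch s eps v.
  by move=> y1 z1; apply/branchE; case: s y1 z1.
have [y1|y1] := eqVneq (v (iY false 1)) 0; last first.
  case/orP => [/= z1|]; [|rewrite addr_eq0 oppr_pchar2 // => /eqP yz]; right.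
    by exists (true, false) => //; apply: brE => //; rewrite mul0r; apply/eqP.
  by exists (true, true) => //; apply: brE => //; rewrite mul1r; apply/esym.
move=> _; have [z1|z1] := eqVneq (v (iZ false 1)) 0; [left|right]; last first.
  by exists (false, false) => //; apply: brE => //; rewrite mul0r.
have yl2 : low 2 (jY false v) by case=> [|[|//]] _; rewrite jE.
have zl2 : low 2 (jZ false v) by case=> [|[|//]] _; rewrite jE.
by split=> // i i3; apply: (on_jets_low_x gv yl2 zl2); lia.
Qed.

Lemma base_irreducible :
  zclosed (fun v => base v) /\ zirreducible (fun v => base v).
Proof.
split; first by exists (@I0_m k m) => v; rewrite I0_mP.
apply: (@zirreducible_closure _ _ (fun v => locus false 2 v)).
- have [|v lv _] := @locus2_dense k k2 m m5 1 _ (base_pointP true).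
    by rewrite meval1 oner_neq0.
  by exists v.
- by move=> v [].
- by move=> p v; apply: locus2_dense.
- exact: locus2_irreducible.
Qed.

Lemma S0_m_decomposition : irreducible_decomposition (@S0_m k m) (@Z_m k m).
Proof.
have J1 := J1_mP; have J2 := J2_mP; have J3 := J3_mP.
have base_branch s eps : ~ base (branch_point s eps).
  move=> [_ yl zl _]; have [[_ _ _ /eqP z1 _] _] := branch_pointP s eps.
  by apply: z1; case: s yl zl => yl zl; [apply: yl|apply: zl].
split; [|split].
- move=> v; split.
    case/S0_m_cover => [bv|[c]]; first by exists (@Ordinal 4 0 isT); apply/I0_mP.
    rewrite !inE => /or3P[] /eqP -> /= brv.
    + by exists (@Ordinal 4 1 isT); apply: branch_sub brv.
    + by exists (@Ordinal 4 2 isT); apply: branch_sub brv.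
    + by exists (@Ordinal 4 3 isT); apply: branch_sub brv.
  case=> -[[|[|[|[|//]]]] i4] Zv; apply/S0_mP.
  + by case/I0_mP/baseE: Zv => [[x0 _ _] [[y0 _ z0 _] gv]].
  + by case: (component_relations J1 Zv) => [[x0 _ y0 z0 _] gv].
  + by case: (component_relations J2 Zv) => [[x0 _ y0 z0 _] gv].
  + by case: (component_relations J3 Zv) => [[x0 _ y0 z0 _] gv].
- case=> -[|[|[|[|//]]]] i4.
  + split; first by exists (@I0_m k m).
    have [_ [[v bv] irr]] := base_irreducible.
    split; first by exists v; apply/I0_mP.
    move=> B C cB cC ZBC; have [|ZB|ZC] := irr B C cB cC.
    * by move=> u /I0_mP/ZBC.
    * by left=> u /I0_mP/ZB.
    * by right=> u /I0_mP/ZC.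
  + exact: (component_irreducible J1).
  + exact: (component_irreducible J2).
  + exact: (component_irreducible J3).
(* [base_point] separates Z_0 from the other components. Each [branch_point] violates a linear
   equation between y_1 and z_1 that holds on every component but its own. *)
move=> i j ij sub.
have [y1 z1] := branch_point_coef false false.
have [z2 y2] := branch_point_coef true false.
have [z3 y3] := branch_point_coef true true.
have B1 := branch_sub J1 (branch_pointP false false).
have B2 := branch_sub J2 (branch_pointP true false).
have B3 := branch_sub J3 (branch_pointP true true).
have one0 : (1 : k) <> 0 by apply/eqP/oner_neq0.
case: i j ij sub => [[|[|[|[|//]]]] i4] [[|[|[|[|//]]]] j4] // _ sub.
- by apply: (base_point_notin J1); apply/sub/I0_mP/base_pointP.
- by apply: (base_point_notin J2); apply/sub/I0_mP/base_pointP.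
- by apply: (base_point_notin J3); apply/sub/I0_mP/base_pointP.
- by apply: (@base_branch false false); apply/I0_mP/sub.
- have [[_ _ _ _]] := component_relations J2 (sub _ B1).
  by rewrite mul0r => z10 _; apply: one0; rewrite -z1.
- have [[_ _ _ _]] := component_relations J3 (sub _ B1).
  by rewrite mul1r => yz _; apply: one0; rewrite -z1 -[RHS]y1.
- by apply: (@base_branch true false); apply/I0_mP/sub.
- have [[_ _ _ _]] := component_relations J1 (sub _ B2).
  by rewrite mul0r => y10 _; apply: one0; rewrite -y2.
- have [[_ _ _ _]] := component_relations J3 (sub _ B2).
  by rewrite mul1r => yz _; apply: one0; rewrite -y2 -[RHS]z2.
- by apply: (@base_branch true true); apply/I0_mP/sub.
- have [[_ _ _ _]] := component_relations J1 (sub _ B3).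
  by rewrite mul0r => y10 _; apply: one0; rewrite -y3.
- have [[_ _ _ _]] := component_relations J2 (sub _ B3).
  by rewrite mul0r => z10 _; apply: one0; rewrite -[LHS]z3.
Qed.

End Components.

Theorem theorem4p12 (k : closedFieldType) (hchar : (2 \in [pchar k])%N)
  (m : nat) (hm : (5 <= m)%N) :
  irreducible_decomposition (@S0_m k m) (@Z_m k m).
Proof. exact: S0_m_decomposition. Qed.
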